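(* Let $K$ be a compact Hausdorff topological space and let $A$ be a uniform algebra on $K$. Then there exists a subset $\Omega\subset K$ such that the restriction map $f\mapsto f|_\Omega$ embeds $A$ isometrically into $C_b(\Omega)$ as a C-rich subspace of $C_b(\Omega)$, and so the inclusion $J:A\to C_b(\Omega)$, $J(f)=f|_\Omega$, is lush. Moreover, if $A$ is unital, then $\Omega$ can be taken to be the Choquet boundary of $A$.
   Context: Scalars are complex. A uniform algebra on $K$ is a closed subalgebra $A\subset C(K)$ that separates the points of $K$; it is unital if it contains the constant function $1$. The Choquet boundary of a unital uniform algebra $A$ is the set of $t\in K$ such that the evaluation functional $\delta_t|_A$ is an extreme point of $\{\varphi\in A^*:\|\varphi\|=\varphi(1)=1\}$. For a completely regular Hausdorff space $\Omega$ (here $\Omega\subset K$ with the relative topology), $C_b(\Omega)$ is the Banach space of bounded continuous scalar functions on $\Omega$ with the sup norm. A closed subspace $X\subset C_b(\Omega)$ is C-rich if for every $\varepsilon>0$ and every nonempty open $U\subset\Omega$ there is a norm-one function $h:\Omega\to[0,1]$ in $C_b(\Omega)$ with $\operatorname{supp}(h)\subset U$ and $\operatorname{dist}(h,X)<\varepsilon$. Lush operator: with $B_X,S_X$ the closed unit ball and unit sphere, $\mathbb{T}$ the set of modulus-one scalars and $\operatorname{aconv}(F)=\operatorname{conv}(\mathbb{T}F)$, a norm-one operator $G\in L(X,Y)$ between Banach spaces is lush if for every $x_0\in B_X$, every $\varepsilon>0$ and every $y\in S_Y$ there is a set $F\subset B_X$ such that $\operatorname{conv}(F)\subset\{x\in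 B_X:\|Gx+y\|>2-\varepsilon\}$ and $\operatorname{dist}(x_0,\operatorname{aconv}(F))<\varepsilon$. *)

(* Defs.v *)
From HB Require Import structures.
From mathcomp Require Import all_boot all_order all_algebra.
From mathcomp Require Import complex.
From mathcomp Require Import all_classical all_reals all_analysis.

Set Implicit Arguments.
Unset Strict Implicit.
Unset Printing Implicit Defensive.

Import Order.TTheory GRing.Theory Num.Theory.
Import numFieldNormedType.Exports.

Local Open Scope classical_set_scope.
Local Open Scope ring_scope.
Local Open Scope complex_scope.

(* [R[i]] carries both an [R]-module and an [R[i]]-module structure; the
   regular alias selects the latter. *)
Notation C_ R := (R[i]^o).

(* Norms of [normedModType R[i]] live in [R[i]]; [rnorm] is the same norm with
   values in [R]. *)
Definition rnorm (R : realType) (V : normedModType R[i]) (x : V) : R :=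
  complex.Re `|x|.

Section RealNorm.
Variables (R : realType) (V : normedModType R[i]).
Implicit Types x y : V.

Lemma leRC (a b : R) : (a%:C <= b%:C) = (a <= b).
Proof. exact: lecR. Qed.

Lemma RCD (a b : R) : (a + b)%:C = a%:C + b%:C.
Proof. exact: rmorphD. Qed.

Lemma RCM (a b : R) : (a * b)%:C = a%:C * b%:C.
Proof. exact: rmorphM. Qed.

Lemma rnormE x : (rnorm x)%:C = `|x|.
Proof. by rewrite /rnorm RRe_real ?normr_real. Qed.

Lemma rnorm_ge0 x : 0 <= rnorm x.
Proof. by rewrite -leRC rnormE normr_ge0. Qed.

Lemma rnormD x y : rnorm (x + y) <= rnorm x + rnorm y.
Proof. by rewrite -leRC RCD !rnormE ler_normD. Qed.

Lemma rnormZ (a : C_ R) x : rnorm (a *: x) = rnorm a * rnorm x.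
Proof. by apply: complexI; rewrite RCM !rnormE normrZ. Qed.

Lemma rnorm0 : rnorm (0 : V) = 0.
Proof. by rewrite /rnorm normr0. Qed.

Lemma rnorm0_eq0 x : rnorm x = 0 -> x = 0.
Proof. by move=> x0; apply/normr0_eq0; rewrite -rnormE x0. Qed.

End RealNorm.

Section BoundedContinuous.
Variables (R : realType) (T : topologicalType).

Definition bcont : {pred T -> C_ R} :=
  fun f => `[< continuous f /\ bounded_fun f >].

Lemma bcontP f : reflect (continuous f /\ exists M : R, forall t, rnorm (f t) <= M)
  (f \in bcont).
Proof.
apply: (iffP (asboolP _)) => -[cf bf]; split => //.
  have [M M0 HM] := pinfty_ex_gt0 bf.
  exists (complex.Re M) => t.
  rewrite -leRC rnormE RRe_real ?gtr0_real//; exact: HM.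
case: bf => M HM; exists M%:C; split; first by rewrite complex_real.
move=> N MN t _ /=; rewrite -rnormE; apply: le_trans (ltW MN).
by rewrite leRC.
Qed.

Lemma bcont_submod : submod_closed bcont.
Proof.
split.
  apply/bcontP; split; first exact: cst_continuous.
  by exists 0 => t /=; rewrite rnorm0.
move=> a f g /bcontP[cf [M fM]] /bcontP[cg [N gN]]; apply/bcontP; split.
  move=> t; apply: continuousD; last exact: cg.
  apply: continuousM; [exact: cst_continuous|exact: cf].
exists (rnorm (a : C_ R) * M + N) => t.
apply: le_trans (rnormD _ _) _; apply: lerD => //.
by rewrite (rnormZ a (f t)) ler_wpM2l ?rnorm_ge0.
Qed.

Lemma bcont_subring : subring_closed bcont.
Proof.
have [sub0 subl] := bcont_submod; split.
- apply/bcontP; split; first exact: cst_continuous.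
  by exists 1 => t /=; rewrite /rnorm normr1.
- move=> f g fb gb; rewrite addrC -scaleN1r; exact: subl.
move=> f g /bcontP[cf [M fM]] /bcontP[cg [N gN]]; apply/bcontP; split.
  by move=> t; apply: continuousM; [exact: cf|exact: cg].
exists (M * N) => t.
by rewrite (rnormZ (f t) (g t)) ler_pM ?rnorm_ge0.
Qed.

HB.instance Definition _ := GRing.isSubringClosed.Build _ bcont bcont_subring.
HB.instance Definition _ := GRing.isScaleClosed.Build _ _ bcont
  (GRing.subsemimod_closedZ (GRing.submod_closed_semi bcont_submod)).

Record Cb := MkCb { Cb_fun :> T -> C_ R; Cb_funP : Cb_fun \in bcont }.

HB.instance Definition _ := [isSub for Cb_fun].
HB.instance Definition _ := [Choice of Cb by <:].
HB.instance Definition _ :=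
  GRing.SubChoice_isSubComPzRing.Build _ _ Cb (subringClosedP bcont).
HB.instance Definition _ := [SubZmodule_isSubLmodule of Cb by <:].

Implicit Types f g : Cb.

(* The default [sup set0 = 0] gives the right value when [T] is empty. *)
Definition sup_norm (f : Cb) : R := sup [set rnorm (f t) | t in setT].

Lemma rnorm_le_sup f t : rnorm (f t) <= sup_norm f.
Proof.
have /bcontP[_ [M fM]] := Cb_funP f.
apply: ub_le_sup; last by exists t.
by exists M => _ [s _ <-].
Qed.

Lemma sup_norm_le f (M : R) : 0 <= M -> (forall t, rnorm (f t) <= M) ->
  sup_norm f <= M.
Proof.
move=> M0 fM; rewrite /sup_norm.
have [->|/set0P ne] := eqVneq [set rnorm (f t) | t in setT] set0.
  by rewrite sup0.
by apply: ge_sup => // _ [t _ <-].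
Qed.

Lemma sup_norm_ge0 f : 0 <= sup_norm f.
Proof.
rewrite /sup_norm.
have [->|/set0P[_ [t _ _]]] := eqVneq [set rnorm (f t) | t in setT] set0.
  by rewrite sup0.
by apply: le_trans (rnorm_le_sup f t); exact: rnorm_ge0.
Qed.

Let Cb_normD f g : (sup_norm (f + g))%:C <= (sup_norm f)%:C + (sup_norm g)%:C.
Proof.
rewrite -RCD leRC sup_norm_le ?addr_ge0 ?sup_norm_ge0// => t.
by apply: le_trans (rnormD (f t) (g t)) _; rewrite lerD ?rnorm_le_sup.
Qed.

Let sup_normZ_le (a : C_ R) f : sup_norm (a *: f) <= rnorm a * sup_norm f.
Proof.
rewrite sup_norm_le ?mulr_ge0 ?sup_norm_ge0 ?rnorm_ge0// => t.
by rewrite (rnormZ a (f t)) ler_wpM2l ?rnorm_ge0 ?rnorm_le_sup.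
Qed.

Let Cb_normZ (a : R[i]) f : (sup_norm (a *: f))%:C = `|a| * (sup_norm f)%:C.
Proof.
rewrite -[`|a|](rnormE (a : C_ R)) -RCM; congr (_ %:C).
apply/eqP; rewrite eq_le sup_normZ_le /=.
have [->|a0] := eqVneq a 0.
  by rewrite rnorm0 mul0r sup_norm_ge0.
have an0 : rnorm (a : C_ R) != 0.
  by apply: contra a0 => /eqP /rnorm0_eq0 ->.
have {1}-> : f = a^-1 *: (a *: f) by rewrite scalerA mulVf// scale1r.
apply: le_trans (ler_wpM2l (rnorm_ge0 _) (sup_normZ_le _ _)) _.
by rewrite mulrA -(rnormZ (a : C_ R) (a^-1 : C_ R)) [_ *: _]mulfV// /rnorm normr1 mul1r.
Qed.

Let Cb_norm0_eq0 f : (sup_norm f)%:C = 0 -> f = 0.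
Proof.
move=> [f0]; apply/val_inj/funext => t /=; apply/rnorm0_eq0/eqP.
by rewrite eq_le rnorm_ge0 andbT -f0 rnorm_le_sup.
Qed.

HB.instance Definition _ := Lmodule_isNormed.Build R[i] Cb
  Cb_normD Cb_normZ Cb_norm0_eq0.

Lemma Cb_rnormE (f : Cb) : rnorm f = sup_norm f.
Proof. by []. Qed.

End BoundedContinuous.
Arguments Cb R T : clear implicits.

(* A linear subspace of a normed space, as a normed space in its own right. *)
Section Subspace.
Variables (R : realType) (V : normedModType R[i]) (S : submodClosed V).

Record subnormed := MkSub { subn_val :> V; subn_valP : subn_val \in S }.

HB.instance Definition _ := [isSub for subn_val].
HB.instance Definition _ := [Choice of subnormed by <:].
HB.instance Definition _ := [SubChoice_isSubLmodule of subnormed by <:].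

Let subn_normD (x y : subnormed) : `|val (x + y)| <= `|val x| + `|val y|.
Proof. exact: ler_normD. Qed.

Let subn_normZ (a : R[i]) (x : subnormed) : `|val (a *: x)| = `|a| * `|val x|.
Proof. exact: normrZ. Qed.

Let subn_norm0_eq0 (x : subnormed) : `|val x| = 0 -> x = 0.
Proof. by move=> /normr0_eq0 x0; apply: val_inj. Qed.

HB.instance Definition _ := Lmodule_isNormed.Build R[i] subnormed
  subn_normD subn_normZ subn_norm0_eq0.

Lemma subn_normE (x : subnormed) : `|x| = `|val x|.
Proof. by []. Qed.

End Subspace.

Section NormedSpaces.
Variable R : realType.

Definition dist (V : normedModType R[i]) (x : V) (S : set V) : \bar R :=
  ereal_inf [set (rnorm (x - y))%:E | y in S].

(* [convex_set] over [R[i]] uses the scalars [0 <= t <= 1] for the order of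
   [R[i]], which are the real numbers of the unit interval. *)
Definition conv_hull (V : lmodType R[i]) (F : set V) : set V :=
  smallest (@convex_set R[i] V) F.

Definition aconv (V : lmodType R[i]) (F : set V) : set V :=
  conv_hull [set t *: x | t in [set t : R[i] | `|t| = 1] & x in F].

Definition extreme_point (V : lmodType R[i]) (S : set V) (x : V) : Prop :=
  S x /\ forall (y z : V) (t : R), S y -> S z -> 0 < t < 1 ->
    x = t%:C *: y + (1 - t)%:C *: z -> y = x /\ z = x.

Definition unit_ball (V : normedModType R[i]) : set V :=
  [set x | rnorm x <= 1].
Definition unit_sphere (V : normedModType R[i]) : set V :=
  [set x | rnorm x = 1].
Arguments unit_ball : clear implicits.
Arguments unit_sphere : clear implicits.

(* Meant for continuous linear [G]. *)
Definition op_norm (X Y : normedModType R[i]) (G : X -> Y) : R :=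
  sup [set rnorm (G x) | x in unit_ball X].

(* The normalisation [op_norm G = 1] excludes the zero space as a domain. *)
Definition lush (X Y : normedModType R[i]) (G : X -> Y) : Prop :=
  [/\ linear G, continuous G, op_norm G = 1
    & forall (x0 : X) (eps : R) (y : Y),
        unit_ball X x0 -> 0 < eps -> unit_sphere Y y ->
        exists F : set X,
          [/\ F `<=` unit_ball X,
              conv_hull F `<=` [set x | unit_ball X x /\ rnorm (G x + y) > 2 - eps]
            & (dist x0 (aconv F) < eps%:E)%E]].

End NormedSpaces.

Section CRich.
Variables (R : realType) (T : topologicalType).

Definition supp (f : Cb R T) : set T := closure [set t | f t != 0].

(* In [R[i]], [0 <= z <= 1] says that [z] is real and lies in the unit
   interval. *)
Definition C_rich (X : set (Cb R T)) : Prop :=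
  [/\ submod_closed (mem X), closed X
    & forall (eps : R) (U : set T), 0 < eps -> open U -> U !=set0 ->
        exists h : Cb R T,
          [/\ rnorm h = 1, forall t, 0 <= h t <= 1, supp h `<=` U
            & (dist h X < eps%:E)%E]].

End CRich.

Section UniformAlgebra.
Variables (R : realType) (K : topologicalType).

(* [K] is meant to be compact, so that [Cb R K] is the space of all continuous
   functions on [K]. *)
Definition uniform_algebra (A : submodClosed (Cb R K)) : Prop :=
  [/\ closed [set f | f \in A],
      {in A &, forall f g, f * g \in A}
    & forall s t : K, s <> t -> exists2 f, f \in A & f s <> f t].

Variable A : submodClosed (Cb R K).

Definition evaluation (t : K) : subnormed A -> C_ R := fun f => val f t.

Definition state_space (A1 : 1 \in A) : set (subnormed A -> C_ R) :=
  [set phi : subnormed A -> C_ R |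
    [/\ linear phi, continuous phi, op_norm phi = 1
      & phi (MkSub A1) = 1]].

Definition Choquet_boundary (A1 : 1 \in A) : set K :=
  [set t | extreme_point (state_space A1) (evaluation t)].

End UniformAlgebra.

Section Restriction.
Variables (R : realType) (K : topologicalType) (Omega : set K).

Lemma restr_subproof (f : Cb R K) : (f \o set_val : Omega -> C_ R) \in
  @bcont R Omega.
Proof.
have /bcontP[cf [M fM]] := Cb_funP f; apply/bcontP; split.
  move=> t; apply: continuous_comp; last exact: cf.
  exact: initial_continuous.
by exists M => t; exact: fM.
Qed.

(* [set_type Omega] carries the relative topology. *)
Definition restr (f : Cb R K) : Cb R Omega := MkCb (restr_subproof f).

Definition restrJ (A : submodClosed (Cb R K)) (f : subnormed A) : Cb R Omega :=
  restr (val f).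

End Restriction.
Arguments restrJ {R K} Omega A f.

(* Main.v *)
Require Import Defs.
From HB Require Import structures.
From mathcomp Require Import all_boot all_order all_algebra.
From mathcomp Require Import complex.
From mathcomp Require Import all_classical all_reals all_analysis.
From mathcomp Require Import ring lra.

Set Implicit Arguments.
Unset Strict Implicit.
Unset Printing Implicit Defensive.

Import Order.TTheory GRing.Theory Num.Theory.
Import numFieldNormedType.Exports.

Local Open Scope classical_set_scope.
Local Open Scope ring_scope.

(* A subspace [B] of C(K) containing 1 and separating points has a norming
   Choquet boundary: say that a state is dominated by a closed set E when it has
   a representing measure on E, and call E a face when a convex combination of
   states dominated by E only involves states dominated by E. The set where
   [Re f] is maximal on a face is a face, so a minimal face inside
   [{Re f = max}] is a point [t], and its evaluation is then extreme.

   Conversely let the evaluation at [t] be extreme, and extend it to a positive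
   functional L on C(K) by Hahn-Banach, with L maximal on a given function. For
   0 < k < 1 the functionals [L (k .) / L k] and [L ((1 - k) .) / L (1 - k)] are
   states with convex combination the evaluation, hence [L (k g) = L k Re (g t)],
   and [L ((Re g)^2) = 0] as soon as [Re (g t) = 0]. By compactness there is,
   for each neighbourhood U of [t], some [g] in B with [Re g >= 0],
   [Re g >= 1] off U and [Re (g t)] as small as desired.

   The averages [1/N sum_(j < N) 1 / (1 + z / 2^j)] map the right half-plane
   close to the segment [0, 1], are near 1 at small z and near 0 at large
   [Re z]; composed with multiples of [g] they give the bump functions of
   C-richness. If A has no unit, take B = A + C1 and multiply the bumps by
   elements of its ideal A.

   For lushness, write [x0 s] as the mean of two unimodular numbers [w1], [w2],
   at a point [s] where [y] almost attains its norm; a bump [f] at [s] gives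
   [x0 + f (wj - x0 s)], almost in the unit ball, with mean [x0] and value about
   [wj] at [s]. *)

(** If [Q C] fails, the sets [S] for which [Q] holds of [C] minus [S] form a proper filter
    containing [C]. A cluster point in [C] has a neighbourhood [N] with [Q N]; the complement of [N]
    then belongs to the filter and yet would have to meet [N]. *)
Lemma compact_local (T : topologicalType) (C : set T) (Q : set T -> Prop) :
  compact C -> Q set0 ->
  (forall S1 S2, Q S2 -> S1 `<=` S2 -> Q S1) ->
  (forall S1 S2, Q S1 -> Q S2 -> Q (S1 `|` S2)) ->
  (forall s, C s -> exists2 N, nbhs s N & Q N) -> Q C.
Proof.
move=> Ccompact Q0 Qsub QU Qloc; apply: contrapT => nQC.
pose F := [set S | Q (C `\` S)].
have FF : Filter F.
  split; first by rewrite /F /= setDT.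
  - by move=> P S FP FS; rewrite /F /= setDIr; exact: QU.
  - by move=> P S PS FP; apply: Qsub FP _; exact: setDS.
have PF : ProperFilter F.
  by split => //; rewrite /F /= setD0.
have [|s [Cs Fs]] := Ccompact F PF; first by rewrite /F /= setDv.
have [N Ns QN] := Qloc s Cs.
have [|x [+ Nx]] := Fs (~` N) N _ Ns.
  by rewrite /F /= setDE setCK; apply: Qsub QN _; exact: subIsetr.
exact.
Qed.

(** * Truncation of the real line to [0, 1] *)

Section Clip.
Variable R : realType.
Implicit Types x y d : R.

Definition clip x : R := Num.max 0 (Num.min 1 x).

Lemma clip_ge0 x : 0 <= clip x. Proof. by rewrite le_max lexx. Qed.

Lemma clip_le1 x : clip x <= 1. Proof. by rewrite ge_max ler01 ge_min lexx. Qed.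

Lemma clip_eq0 x : x <= 0 -> clip x = 0.
Proof. by move=> x0; apply/max_idPl; rewrite ge_min x0 orbT. Qed.

Lemma clip_eq1 x : 1 <= x -> clip x = 1.
Proof. by move=> x1; rewrite /clip (min_idPl x1); apply/max_idPr. Qed.

Lemma clip_id x : 0 <= x <= 1 -> clip x = x.
Proof. by move=> /andP[x0 x1]; rewrite /clip (min_idPr x1); apply/max_idPr. Qed.

Lemma clip_homo x y : x <= y -> clip y - clip x <= y - x.
Proof.
move=> xy; rewrite /clip.
case: (leP 1 y) => y1; case: (leP 1 x) => x1; rewrite ?(max_idPr ler01).
- by rewrite subrr subr_ge0.
- by case: (leP 0 x) => x0; lra.
- by lra.
- by case: (leP 0 x) => x0; case: (leP 0 y) => y0; lra.
Qed.

Lemma le_clip x y : x <= y -> clip x <= clip y.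
Proof.
move=> xy; have [x0|x0] := leP x 0; first by rewrite clip_eq0// clip_ge0.
have [y1|y1] := leP 1 y; first by rewrite (clip_eq1 y1) clip_le1.
by rewrite !clip_id//; apply/andP; split; lra.
Qed.

Lemma clip_lipschitz x y : `|clip x - clip y| <= `|x - y|.
Proof.
wlog xy : x y / x <= y.
  by move=> H; have [/H//|/ltW/H] := leP x y; rewrite distrC (distrC y).
rewrite distrC (distrC x) !ger0_norm ?subr_ge0 ?le_clip//; exact: clip_homo.
Qed.

Lemma clip_near x d : 0 <= d -> - d <= x <= 1 + d -> `|x - clip x| <= d.
Proof.
move=> d0 /andP[dx xd]; have [x0|x0] := leP x 0.
  by rewrite clip_eq0// subr0 ler0_norm//; lra.
have [x1|x1] := leP 1 x.
  by rewrite clip_eq1// ger0_norm ?subr_ge0//; lra.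
by rewrite clip_id ?(ltW x0) ?(ltW x1)// subrr normr0.
Qed.

End Clip.

(** * Complex numbers with real-valued modulus, and pointwise calculus in [Cb] *)

Section ComplexNumbers.
Variable R : realType.
Local Open Scope complex_scope.
Implicit Types z w : C_ R.
Local Notation Re := complex.Re.
Local Notation Im := complex.Im.

Lemma ReCD z w : Re (z + w) = Re z + Re w. Proof. by case: z w => a b []. Qed.
Lemma ImCD z w : Im (z + w) = Im z + Im w. Proof. by case: z w => a b []. Qed.
Lemma ReCN z : Re (- z) = - Re z. Proof. by case: z. Qed.
Lemma ImCN z : Im (- z) = - Im z. Proof. by case: z. Qed.
Lemma ReCB z w : Re (z - w) = Re z - Re w. Proof. by rewrite ReCD ReCN. Qed.
Lemma ImCB z w : Im (z - w) = Im z - Im w. Proof. by rewrite ImCD ImCN. Qed.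
Lemma ReCM z w : Re (z * w) = Re z * Re w - Im z * Im w.
Proof. by case: z w => a b []. Qed.
Lemma ImCM z w : Im (z * w) = Re z * Im w + Im z * Re w.
Proof. by case: z w => a b []. Qed.

Lemma complex_ext z w : Re z = Re w -> Im z = Im w -> z = w.
Proof. by case: z w => a b [c d] /= -> ->. Qed.

Lemma rnormC z : rnorm z = Num.sqrt (Re z ^+ 2 + Im z ^+ 2).
Proof. by rewrite /rnorm normc_def. Qed.

Lemma sqr_rnorm z : rnorm z ^+ 2 = Re z ^+ 2 + Im z ^+ 2.
Proof. by rewrite rnormC sqr_sqrtr// addr_ge0 ?sqr_ge0. Qed.

Lemma rnorm_le z (r : R) : 0 <= r -> Re z ^+ 2 + Im z ^+ 2 <= r ^+ 2 ->
  rnorm z <= r.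
Proof. by move=> r0; rewrite -sqr_rnorm ler_sqr// nnegrE rnorm_ge0. Qed.

Lemma normr_Re z : `|Re z| <= rnorm z.
Proof.
rewrite -(@ler_pXn2r _ 2)// ?nnegrE ?rnorm_ge0// sqr_rnorm real_normK ?num_real//.
by rewrite lerDl sqr_ge0.
Qed.

Lemma normr_Im z : `|Im z| <= rnorm z.
Proof.
rewrite -(@ler_pXn2r _ 2)// ?nnegrE ?rnorm_ge0// sqr_rnorm real_normK ?num_real//.
by rewrite lerDr sqr_ge0.
Qed.

Lemma Re_le z : Re z <= rnorm z.
Proof. exact: le_trans (ler_norm _) (normr_Re _). Qed.

Lemma rnorm_ReIm z : rnorm z <= `|Re z| + `|Im z|.
Proof.
apply: rnorm_le; first by rewrite addr_ge0.
rewrite sqrrD !real_normK ?num_real// lerD2r lerDl mulrn_wge0//.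
Qed.

Lemma rnormM z w : rnorm (z * w : C_ R) = rnorm z * rnorm w.
Proof. exact: (rnormZ z w). Qed.

Lemma rnormX z n : rnorm (z ^+ n : C_ R) = rnorm z ^+ n.
Proof. by elim: n => [|n IH]; rewrite ?expr0 ?exprS ?rnormM ?IH// /rnorm normr1. Qed.

Lemma rnormN (V : normedModType R[i]) (x : V) : rnorm (- x) = rnorm x.
Proof. by rewrite /rnorm normrN. Qed.

Lemma rnormBC (V : normedModType R[i]) (x y : V) : rnorm (x - y) = rnorm (y - x).
Proof. by rewrite /rnorm distrC. Qed.

Lemma rnorm1 : rnorm (1 : C_ R) = 1. Proof. by rewrite /rnorm normr1. Qed.

Lemma rnorm_RC (r : R) : rnorm (r%:C : C_ R) = `|r|.
Proof. by rewrite rnormC /= expr0n addr0 sqrtr_sqr. Qed.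

Lemma rnormZR (V : normedModType R[i]) (r : R) (x : V) : 0 <= r ->
  rnorm (r%:C *: x) = r * rnorm x.
Proof. by move=> r0; rewrite rnormZ rnorm_RC ger0_norm. Qed.

Lemma rnormBD (V : normedModType R[i]) (x y z : V) :
  rnorm (x - z) <= rnorm (x - y) + rnorm (y - z).
Proof. by rewrite -[x - z](subrKA y) rnormD. Qed.

Lemma unit_rotation z : exists2 w : C_ R, rnorm w = 1 & w * z = (rnorm z)%:C.
Proof.
have [->|z0] := eqVneq z 0.
  by exists 1; rewrite ?rnorm1// mul1r rnorm0.
have nz0 : rnorm z != 0 by apply: contra z0 => /eqP/rnorm0_eq0 ->.
exists ((rnorm z)%:C / z); last by rewrite mulfVK.
apply: (mulIf nz0); rewrite -rnormM mulfVK// rnorm_RC ger0_norm ?rnorm_ge0//.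
by rewrite mul1r.
Qed.

(** After a rotation [z] is a real [r] in [0, 1], the mean of the two points of the unit circle with
    real part [r]. *)
Lemma mean_unimodular z : rnorm z <= 1 ->
  exists w1 w2 : C_ R, [/\ rnorm w1 = 1, rnorm w2 = 1 & w1 + w2 = 2%:R * z].
Proof.
move=> z1; have [w w1 wz] := unit_rotation z.
have w0 : w != 0.
  by apply/negP => /eqP w0; move: w1; rewrite w0 rnorm0 => /eqP; rewrite eq_sym oner_eq0.
pose r := rnorm z; pose q := Num.sqrt (1 - r ^+ 2).
have q2 : q ^+ 2 = 1 - r ^+ 2.
  by rewrite sqr_sqrtr// subr_ge0 expr_le1// rnorm_ge0.
have nw (s : R) : s ^+ 2 = 1 - r ^+ 2 -> rnorm ((r +i* s) / w : C_ R) = 1.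
  move=> s2; apply: (mulIf (oner_neq0 R)); rewrite -{1}w1 -rnormM mulfVK//.
  by rewrite rnormC /= s2 addrC subrK sqrtr1 mulr1.
exists ((r +i* q) / w), ((r -i* q) / w); rewrite !nw ?sqrrN//; split => //.
have -> : z = r%:C / w by rewrite /r -wz mulrAC mulfV// mul1r.
by rewrite -mulrDl mulrA; congr (_ / _); apply: complex_ext => /=; ring.
Qed.

(** Positive elements of [R[i]] are real, so real tolerances suffice. *)
Lemma ccontinuousP (T : topologicalType) (f : T -> C_ R) :
  continuous f <->
  (forall t (e : R), 0 < e -> \forall s \near t, rnorm (f s - f t) < e).
Proof.
split=> [cf t e e0|cf t].
  have /cvgrPdist_lt/(_ e%:C) := cf t.
  rewrite -[_ < e%:C]/(0 < e%:C) ltcR => /(_ e0); apply: filterS => s.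
  by rewrite distrC -rnormE ltcR.
apply/cvgrPdist_lt => e e0.
have er : e = (Re e)%:C by rewrite RRe_real// gtr0_real.
have {}e0 : 0 < Re e by move: e0; rewrite er ltcR.
have := cf t _ e0; apply: filterS => s.
by rewrite er distrC -rnormE ltcR.
Qed.

Lemma Re_continuous (T : topologicalType) (f : T -> C_ R) :
  continuous f -> continuous (fun t => Re (f t)).
Proof.
move=> /ccontinuousP cf t; apply/cvgrPdist_lt => e e0.
have := cf t e e0; apply: filterS => s; apply: le_lt_trans.
by rewrite distrC -ReCB normr_Re.
Qed.

Lemma Cb_continuous (T : topologicalType) (f : Cb R T) : continuous f.
Proof. by have /bcontP[] := Cb_funP f. Qed.

Lemma Cb_near (T : topologicalType) (f : Cb R T) t (e : R) : 0 < e ->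
  \forall s \near t, rnorm (f s - f t) < e.
Proof. by move: t e; apply/ccontinuousP; exact: Cb_continuous. Qed.

Lemma rnorm_app (T : topologicalType) (f : Cb R T) t : rnorm (f t) <= rnorm f.
Proof. exact: rnorm_le_sup. Qed.

Lemma rnorm_CbP (T : topologicalType) (f : Cb R T) (M : R) : 0 <= M ->
  (rnorm f <= M) <-> (forall t, rnorm (f t) <= M).
Proof.
move=> M0; split=> [fM t|fM]; first exact: le_trans (rnorm_app f t) fM.
exact: sup_norm_le.
Qed.

Lemma Cb_ext (T : topologicalType) (f g : Cb R T) : (forall t, f t = g t) -> f = g.
Proof. by move=> fg; apply/val_inj/funext. Qed.

Lemma Cb_exists (T : topologicalType) (f : T -> C_ R) (M : R) :
  continuous f -> (forall t, rnorm (f t) <= M) ->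
  exists g : Cb R T, forall t, g t = f t.
Proof.
move=> cf fM; have fb : f \in @bcont R T by apply/bcontP; split=> //; exists M.
by exists (MkCb fb).
Qed.

Lemma Cb_mulE (T : topologicalType) (f g : Cb R T) t : (f * g) t = f t * g t.
Proof. by []. Qed.

Lemma Cb_scaleE (T : topologicalType) (a : C_ R) (f : Cb R T) t :
  (a *: f) t = a * f t.
Proof. by []. Qed.

Lemma Re_scaleR (T : topologicalType) (a : R) (f : Cb R T) t :
  Re ((a%:C *: f) t) = a * Re (f t).
Proof. by rewrite Cb_scaleE ReCM /= mul0r subr0. Qed.

Lemma Cb_addE (T : topologicalType) (f g : Cb R T) t : (f + g) t = f t + g t.
Proof. by []. Qed.

Lemma Cb_oppE (T : topologicalType) (f : Cb R T) t : (- f) t = - f t.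
Proof. by []. Qed.

Lemma Cb_constE (T : topologicalType) (a : C_ R) (t : T) : (a *: (1 : Cb R T)) t = a.
Proof. exact: mulr1. Qed.

Lemma Cb_scalerAr (T : topologicalType) (a : C_ R) (f g : Cb R T) :
  f * (a *: g) = a *: (f * g).
Proof. by apply: Cb_ext => t; rewrite Cb_scaleE !Cb_mulE Cb_scaleE mulrCA. Qed.

Lemma Cb_scalerAl (T : topologicalType) (a : C_ R) (f g : Cb R T) :
  (a *: f) * g = a *: (f * g).
Proof. by rewrite mulrC Cb_scalerAr mulrC. Qed.

End ComplexNumbers.

(** * The Hahn-Banach theorem for sublinear functionals *)

Section HahnBanach.
Variables (R : realType) (V : lmodType R).
Implicit Types (p q : V -> R) (x y : V).

Definition sublinear p :=
  (forall x y, p (x + y) <= p x + p y) /\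
  (forall (t : R) x, 0 < t -> p (t *: x) = t * p x).

Lemma sublinear0 p : sublinear p -> p 0 = 0.
Proof.
move=> [_ /(_ 2%:R 0 (ltr0n _ 2))]; rewrite scaler0; lra.
Qed.

Lemma sublinear_opp_ge p x : sublinear p -> - p (- x) <= p x.
Proof.
move=> sp; have := sp.1 x (- x); rewrite subrr sublinear0//; lra.
Qed.

Let shift_set p y x := [set p (x + t *: y) - t * p y | t in [set t : R | 0 <= t]].

Lemma shift_set_lb p y x : sublinear p -> lbound (shift_set p y x) (- p (- x)).
Proof.
move=> sp _ [t /= t0 <-].
have pty : p (t *: y) = t * p y.
  move: t0; rewrite le_eqVlt => /predU1P[<-|]; last exact: sp.2.
  by rewrite scale0r mul0r sublinear0.
have := sp.1 (x + t *: y) (- x); rewrite addrAC subrr add0r pty; lra.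
Qed.

(** For sublinear [p] this refinement lies below [p], and [t = 1] bounds its value at [- y] by
    [- p y]; hence a linear functional below it must attain [p] at [y]. *)
Definition sublinear_shift p y x : R := inf (shift_set p y x).

Lemma sublinear_shift_le p y x (t : R) : sublinear p -> 0 <= t ->
  sublinear_shift p y x <= p (x + t *: y) - t * p y.
Proof.
move=> sp t0; apply: ge_inf; last by exists t.
by exists (- p (- x)); exact: shift_set_lb.
Qed.

Lemma sublinear_shift_ge p y x (m : R) :
  (forall t : R, 0 <= t -> m <= p (x + t *: y) - t * p y) ->
  m <= sublinear_shift p y x.
Proof.
move=> mle; apply: lb_le_inf; last by move=> _ [t t0 <-]; exact: mle.
by exists (p (x + 0 *: y) - 0 * p y); exists 0 => /=.
Qed.

(** Parameters [t1] for [x1] and [t2] for [x2] combine into [t1 + t2] for the sum. Homogeneity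
    rescales the parameter, and the reverse inequality is the same one for the inverse factor. *)
Lemma sublinear_shiftP p y : sublinear p -> sublinear (sublinear_shift p y).
Proof.
move=> sp; set q := sublinear_shift p y.
have qZ (s : R) x : 0 < s -> q (s *: x) <= s * q x.
  move=> s0; rewrite -ler_pdivrMl//; apply: sublinear_shift_ge => t t0.
  rewrite ler_pdivrMl//.
  have := @sublinear_shift_le p y (s *: x) (s * t) sp (mulr_ge0 (ltW s0) t0).
  by rewrite -scalerA -scalerDr sp.2// -mulrA -mulrBr.
split=> [x1 x2|s x s0]; last first.
  apply/eqP; rewrite eq_le qZ//=.
  have := @qZ s^-1 (s *: x); rewrite invr_gt0 => /(_ s0).
  by rewrite scalerA mulVf ?gt_eqF// scale1r ler_pdivlMl.
rewrite -lerBlDr; apply: sublinear_shift_ge => t1 t10.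
rewrite lerBlDr -lerBlDl; apply: sublinear_shift_ge => t2 t20.
have := @sublinear_shift_le p y (x1 + x2) (t1 + t2) sp (addr_ge0 t10 t20).
have := sp.1 (x1 + t1 *: y) (x2 + t2 *: y).
rewrite addrACA -scalerDl -/q; lra.
Qed.

(** The pointwise infimum works: for subadditivity, two members of the chain are both replaced by
    the smaller one. It is finite because every member is at least [- p (- x)] at [x]. *)
Lemma inf_chain_sublinear p (A : set (V -> R)) :
  A !=set0 -> (forall q, A q -> sublinear q /\ forall x, q x <= p x) ->
  (forall q1 q2, A q1 -> A q2 ->
    (forall x, q1 x <= q2 x) \/ (forall x, q2 x <= q1 x)) ->
  exists q, [/\ sublinear q, forall x, q x <= p x
    & forall q', A q' -> forall x, q x <= q' x].
Proof.
move=> [q0 Aq0] Ap Atot; pose S x := [set q x | q in A].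
have Slb x : has_lbound (S x).
  exists (- p (- x)) => _ [q /Ap[sq qp] <-].
  by apply: le_trans (sublinear_opp_ge _ sq); rewrite lerN2.
have le_S q x : A q -> inf (S x) <= q x.
  by move=> Aq; apply: ge_inf; [exact: Slb|exists q].
have S_ge x m : (forall q, A q -> m <= q x) -> m <= inf (S x).
  move=> mq; apply: lb_le_inf; first by exists (q0 x); exists q0.
  by move=> _ [q Aq <-]; exact: mq.
exists (fun x => inf (S x)); split=> [|x|q' Aq' x]; last exact: le_S.
  2: by apply: le_trans (le_S _ _ Aq0) _; have [_] := Ap _ Aq0; exact.
split=> [x y|t x t0].
  rewrite -lerBlDr; apply: (S_ge _ _) => q1 Aq1.
  rewrite lerBlDr -lerBlDl; apply: S_ge => q2 Aq2; rewrite lerBlDl.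
  have [q12|q21] := Atot _ _ Aq1 Aq2.
    apply: le_trans (le_S _ (x + y) Aq1) _.
    by apply: le_trans ((Ap _ Aq1).1.1 x y) _; rewrite lerD2l.
  apply: le_trans (le_S _ (x + y) Aq2) _.
  by apply: le_trans ((Ap _ Aq2).1.1 x y) _; rewrite lerD2r.
apply/eqP; rewrite eq_le; apply/andP; split.
  rewrite -ler_pdivrMl//; apply: S_ge => q Aq; rewrite ler_pdivrMl//.
  by rewrite -(Ap _ Aq).1.2//; exact: le_S.
apply: S_ge => q Aq; rewrite (Ap _ Aq).1.2// ler_pM2l//; exact: le_S.
Qed.

(* A minimal sublinear functional below [p] is linear: refining it in the
   direction [y] cannot decrease it, so it is odd. *)
Lemma sublinear_linear_minorant p : sublinear p ->
  exists L : V -> R, [/\ forall x y, L (x + y) = L x + L y,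
    forall (t : R) x, 0 < t -> L (t *: x) = t * L x & forall x, L x <= p x].
Proof.
move=> sp; pose T := {q : V -> R | sublinear q /\ forall x, q x <= p x}.
(* The order is reversed, so that a maximal element is a minimal functional. *)
pose rel (q1 q2 : T) := `[< forall x, sval q2 x <= sval q1 x >].
have [||||[L [sL Lp]] Lmin] := @Zorn T rel.
- by move=> q; apply/asboolP.
- move=> q r s /asboolP qr /asboolP rs; apply/asboolP => x.
  exact: le_trans (rs x) (qr x).
- move=> [q Pq] [r Pr] /asboolP qr /asboolP rq; apply: eq_exist.
  by apply/funext => x; apply/le_anti; rewrite qr rq.
- move=> A Atot; have [->|/set0P[q0 Aq0]] := eqVneq A set0.
    by exists (exist _ p (conj sp (fun=> lexx _))).
  have [|_ [q _ <-]|_ _ [q1 Aq1 <-] [q2 Aq2 <-]|q [sq qp qA]] :=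
      @inf_chain_sublinear p [set sval q | q in A].
  + by exists (sval q0); exists q0.
  + exact: (svalP q).
  + by have [/asboolP|/asboolP] := Atot _ _ Aq1 Aq2; [right|left].
  + by exists (exist _ q (conj sq qp)) => r Ar; apply/asboolP/qA; exists r.
have LN x : L (- x) = - L x.
  have sL' := sublinear_shiftP x sL.
  have L'L y : sublinear_shift L x y <= L y.
    by have := @sublinear_shift_le L x y 0 sL (lexx _); rewrite scale0r addr0 mul0r subr0.
  have L'p y : sublinear_shift L x y <= p y by exact: le_trans (L'L y) (Lp y).
  have [LE] := Lmin (exist _ _ (conj sL' L'p)) (introT (asboolP _) L'L).
  have := @sublinear_shift_le L x (- x) 1 sL ler01.
  rewrite LE scale1r addNr sublinear0// sub0r mul1r => Lx.
  have := sublinear_opp_ge x sL; lra.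
exists L; split => // [x y|t x t0]; last exact: sL.2.
by have := sL.1 x y; have := sL.1 (- x) (- y); rewrite -opprD !LN; lra.
Qed.

Lemma sublinear_support p x0 : sublinear p ->
  exists L : V -> R, [/\ forall x y, L (x + y) = L x + L y,
    forall (t : R) x, 0 < t -> L (t *: x) = t * L x,
    forall x, L x <= p x & L x0 = p x0].
Proof.
move=> sp; have [L [LD LZ Lq]] := sublinear_linear_minorant (sublinear_shiftP x0 sp).
have Lp x : L x <= p x.
  apply: le_trans (Lq x) _.
  by have := @sublinear_shift_le p x0 x 0 sp (lexx _); rewrite scale0r addr0 mul0r subr0.
exists L; split => //; apply/eqP; rewrite eq_le Lp/=.
have L0 : L 0 = 0 by have := LD 0 0; rewrite addr0; lra.
have := LD x0 (- x0); rewrite subrr L0.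
have := @sublinear_shift_le p x0 (- x0) 1 sp ler01.
rewrite scale1r addNr sublinear0//; have := Lq (- x0); lra.
Qed.

End HahnBanach.

(** * Complex vector spaces as real ones *)

Section Realification.
Variables (R : realType) (V : lmodType R[i]).
Local Open Scope complex_scope.

(** The alias carries the real scaling through [a%:C], so that Hahn-Banach over [R] applies to a
    complex space. *)
Definition realification : Type := V.

HB.instance Definition _ := GRing.Zmodule.on realification.

Let rscale (a : R) (x : realification) : realification := a%:C *: (x : V).

Let rscaleA a b x : rscale a (rscale b x) = rscale (a * b) x.
Proof. by rewrite /rscale scalerA RCM. Qed.

Let rscale1 : left_id 1 rscale.
Proof. by move=> x; exact: scale1r. Qed.

Let rscaleDr : right_distributive rscale +%R.
Proof. by move=> a x y; exact: scalerDr. Qed.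

Let rscaleDl x : {morph rscale^~ x : a b / a + b}.
Proof. by move=> a b; rewrite /rscale RCD scalerDl. Qed.

HB.instance Definition _ :=
  GRing.Zmodule_isLmodule.Build R realification rscaleA rscale1 rscaleDr rscaleDl.

End Realification.

(** * Linear contractions and the operator norm *)

Section LinearContractions.
Variables (R : realType) (X Y : normedModType R[i]).
Local Open Scope complex_scope.
Implicit Type f : X -> Y.

Lemma linearD_of f : linear f -> forall x y, f (x + y) = f x + f y.
Proof. by move=> lf x y; have := lf 1 x y; rewrite !scale1r. Qed.

Lemma linear0_of f : linear f -> f 0 = 0.
Proof.
move=> lf; have := linearD_of lf 0 0; rewrite addr0 => /esym/eqP.
by rewrite -subr_eq0 addrK => /eqP.
Qed.

Lemma linearZ_of f : linear f -> forall a x, f (a *: x) = a *: f x.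
Proof. by move=> lf a x; have := lf a x 0; rewrite linear0_of// !addr0. Qed.

Lemma linearB_of f : linear f -> forall x y, f (x - y) = f x - f y.
Proof.
by move=> lf x y; rewrite linearD_of// -[- y]scaleN1r linearZ_of// scaleN1r.
Qed.

Lemma contraction_continuous f : linear f ->
  (forall x, rnorm (f x) <= rnorm x) -> continuous f.
Proof.
move=> lf fle x; apply/cvgrPdist_lt => e e0.
have er : e = (complex.Re e)%:C by rewrite RRe_real// gtr0_real.
have /cvgrPdist_lt/(_ e e0) : (y @[y --> x] --> x) by exact: cvg_id.
apply: filterS => y; rewrite er -!rnormE !ltcR -linearB_of//.
exact: le_lt_trans.
Qed.

Lemma op_norm1 f (x0 : X) : (forall x, rnorm (f x) <= rnorm x) ->
  rnorm x0 <= 1 -> rnorm (f x0) = 1 -> op_norm f = 1.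
Proof.
move=> fle x01 fx0; have ub1 : ubound [set rnorm (f x) | x in @unit_ball R X] 1.
  by move=> _ [x x1 <-]; exact: le_trans (fle x) x1.
apply/eqP; rewrite eq_le; apply/andP; split.
  by apply: ge_sup => //; exists 1; exists x0.
by apply: ub_le_sup; [exists 1|exists x0].
Qed.

(** The supremum defining [op_norm] is informative only when the values are bounded; continuity at 0
    supplies a ball of radius [d] sent into the unit ball, hence the bound [2 / d]. *)
Lemma le_op_norm f : linear f -> continuous f ->
  forall x, rnorm (f x) <= op_norm f * rnorm x.
Proof.
move=> lf cf.
have [d d0 fd] : exists2 d : R, 0 < d & forall x, rnorm x < d -> rnorm (f x) < 1.
  have /cvgrPdist_lt/(_ 1 ltr01)/nbhs_ballP[e /= e0 ef] := cf 0.
  have er : e = (complex.Re e)%:C by rewrite RRe_real// gtr0_real.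
  exists (complex.Re e); first by move: e0; rewrite er ltcR.
  move=> x xe; have := ef x; rewrite -ball_normE /= sub0r normrN.
  rewrite -rnormE er ltcR => /(_ xe).
  by rewrite linear0_of// sub0r normrN -rnormE (ltcR _ 1).
have hub : has_ubound [set rnorm (f x) | x in @unit_ball R X].
  exists (2 / d) => _ [x x1 <-].
  have : rnorm (f ((d / 2)%:C *: x)) < 1.
    apply: fd; rewrite rnormZR ?divr_ge0 ?(ltW d0)//.
    by have := ler_wpM2l (ltW d0) x1; lra.
  rewrite linearZ_of// rnormZR ?divr_ge0 ?(ltW d0)// => /ltW.
  by rewrite -ler_pdivlMl ?divr_gt0// invfM invrK mulr1 mulrC.
move=> x; have [x0|x0] := eqVneq (rnorm x) 0.
  by rewrite (rnorm0_eq0 x0) linear0_of// !rnorm0 mulr0.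
have xpos : 0 < rnorm x by rewrite lt_neqAle eq_sym x0 rnorm_ge0.
rewrite -ler_pdivrMr// mulrC -rnormZR ?invr_ge0 ?rnorm_ge0// -linearZ_of//.
apply: ub_le_sup => //; exists ((rnorm x)^-1%:C *: x) => //=.
by rewrite /unit_ball /= rnormZR ?invr_ge0 ?rnorm_ge0// mulVf.
Qed.

End LinearContractions.

(** * States of a unital function space *)

Section States.
Variables (R : realType) (K : topologicalType) (B : submodClosed (Cb R K)).
Hypothesis B1 : 1 \in B.
Local Open Scope complex_scope.
Local Notation Re := complex.Re.
Local Notation Im := complex.Im.

Lemma rnorm_Cb1 (t : K) : rnorm (1 : Cb R K) = 1.
Proof.
apply/eqP; rewrite eq_le; apply/andP; split.
  by apply/rnorm_CbP => // s; rewrite rnorm1.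
by rewrite -{1}(rnorm1 R); exact: (rnorm_app (1 : Cb R K) t).
Qed.

(** A contraction with value 1 at the constant 1 has norm exactly one. The point [t] witnesses that
    [K] is nonempty, so that the constant 1 has norm one. *)
Lemma state_spaceP (t : K) (phi : subnormed B -> C_ R) :
  state_space B1 phi <-> [/\ linear phi,
    forall f, rnorm (phi f) <= rnorm f & phi (MkSub B1) = 1].
Proof.
split=> [[lphi cphi nphi phi1]|[lphi phile phi1]]; split => //.
- by move=> f; have := le_op_norm lphi cphi f; rewrite nphi mul1r.
- exact: contraction_continuous.
- apply: (@op_norm1 _ _ _ _ (MkSub B1)) => //; last by rewrite phi1 rnorm1.
  by rewrite [rnorm _](rnorm_Cb1 t).
Qed.

Lemma evaluation_state (t : K) : state_space B1 (@evaluation R K B t).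
Proof.
apply/(state_spaceP t); split; last by [].
  move=> a f g; rewrite /evaluation.
  have -> : val (a *: f + g) = a *: val f + val g by [].
  by rewrite Cb_addE Cb_scaleE.
by move=> f; exact: (rnorm_app (val f)).
Qed.

End States.

(** * Positive extensions of an extreme evaluation *)

Section ExtremeEvaluations.
Variables (R : realType) (K : topologicalType) (B : submodClosed (Cb R K)).
Hypothesis B1 : 1 \in B.
Local Open Scope complex_scope.
Local Notation Re := complex.Re.
Local Notation Im := complex.Im.

Section PositiveFunctional.
Variables (t : K) (L : Cb R K -> R).
Hypothesis LD : forall f g, L (f + g) = L f + L g.
Hypothesis LZ : forall (a : R) f, 0 < a -> L (a%:C *: f) = a * L f.
Hypothesis Lpos : forall f : Cb R K, (forall s, 0 <= Re (f s)) -> 0 <= L f.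
Hypothesis LB : forall f : Cb R K, f \in B -> L f = Re (f t).

Lemma positive0 : L 0 = 0. Proof. by have := LD 0 0; rewrite addr0; lra. Qed.

Lemma positiveN f : L (- f) = - L f.
Proof. by have := LD f (- f); rewrite subrr positive0; lra. Qed.

Lemma positiveB f g : L (f - g) = L f - L g.
Proof. by rewrite LD positiveN. Qed.

Lemma positiveZ (a : R) f : L (a%:C *: f) = a * L f.
Proof.
have [a0|a0|->] := ltgtP a 0; last by rewrite scale0r mul0r positive0.
  have -> : a%:C *: f = - ((- a)%:C *: f) by rewrite rmorphN scaleNr opprK.
  by rewrite positiveN LZ ?oppr_gt0// mulNr opprK.
exact: LZ.
Qed.

Lemma positive_le (f g : Cb R K) : (forall s, Re (f s) <= Re (g s)) -> L f <= L g.
Proof.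
move=> fg; rewrite -subr_ge0 -positiveB; apply: Lpos => s.
rewrite ReCB subr_ge0; exact: fg.
Qed.

Lemma positive_Re (f g : Cb R K) : (forall s, Re (f s) = Re (g s)) -> L f = L g.
Proof. by move=> fg; apply/le_anti; rewrite !positive_le// => s; rewrite fg. Qed.

(* The functional [f |-> L_C (k f) / L k], where [L_C] extends [L] to a
   complex-linear functional. *)
Definition density (k : Cb R K) (f : subnormed B) : C_ R :=
  (L (k * val f) / L k) +i* (- L (k * ('i *: val f)) / L k).

Lemma density_linear k : linear (density k).
Proof.
have D f g : density k (f + g) = density k f + density k g.
  by apply: complex_ext; rewrite /density/= ?scalerDr mulrDr LD; ring.
have ZR (a : R) f : density k (a%:C *: f) = a%:C * density k f.
  apply: complex_ext; rewrite /density/=.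
    by rewrite Cb_scalerAr positiveZ; ring.
  have -> : 'i *: (a%:C *: val f) = a%:C *: ('i *: val f).
    by rewrite !scalerA mulrC.
  by rewrite Cb_scalerAr positiveZ; ring.
have Zi f : density k ('i *: f) = 'i * density k f.
  apply: complex_ext; rewrite /density/=; first by ring.
  rewrite scalerA (_ : 'i * 'i = -1); last by rewrite -expr2 sqr_i.
  by rewrite scaleN1r mulrN positiveN; ring.
move=> a f g; rewrite D; congr (_ + _).
have -> : a *: f = (Re a)%:C *: f + 'i *: ((Im a)%:C *: f).
  by rewrite scalerA -scalerDl -complexE.
by rewrite D Zi !ZR mulrA -mulrDl -complexE.
Qed.

(** Contractivity: a rotation of [f] makes its value a nonnegative real, which involves only the
    real part of the rotated function; positivity then bounds it by [rnorm f]. *)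
Lemma density_state (k : Cb R K) : (forall s, 0 <= Re (k s) /\ Im (k s) = 0) ->
  0 < L k -> state_space B1 (density k).
Proof.
move=> k0 Lk; apply/(state_spaceP B1 t).
have k1 : density k (MkSub B1) = 1.
  apply: complex_ext; rewrite /density /=; first by rewrite mulr1 mulfV ?gt_eqF.
  rewrite (@positive_Re _ 0) ?positive0 ?oppr0 ?mul0r// => s.
  by rewrite Cb_mulE Cb_constE ReCM (k0 s).2 /= mulr0 mul0r subr0.
split => //; first exact: density_linear.
move=> f; have [w w1 wf] := unit_rotation (density k f).
have : (rnorm (density k f))%:C = density k (w *: f).
  by rewrite -wf (linearZ_of (density_linear k)).
move=> /(congr1 (@complex.Re R)) /= ->.
rewrite ler_pdivrMr// -positiveZ; apply: positive_le => s.
rewrite Cb_mulE !Cb_scaleE ReCM (k0 s).2 mul0r subr0 [X in _ <= X]ReCM /= mul0r subr0 mulrC.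
apply: ler_wpM2r; first exact: (k0 s).1.
by apply: le_trans (Re_le _) _; rewrite rnormM w1 mul1r rnorm_app.
Qed.

Lemma extreme_functional_multiplicative (k g : Cb R K) :
  extreme_point (state_space B1) (@evaluation R K B t) ->
  (forall s, Im (k s) = 0) -> g \in B -> L (k * g) = L k * Re (g t).
Proof.
move=> [_ ext] kim gB.
have L1 : L 1 = 1 by rewrite LB.
(* With values in [1/4, 3/4] both [h] and [1 - h] are nonnegative and [L h] lies strictly between 0
   and 1, so the two densities are states and extremality identifies the density of [h] with the
   evaluation. *)
have small (h : Cb R K) : (forall s, 4^-1 <= Re (h s) <= 3 / 4) -> (forall s, Im (h s) = 0) ->
    L (h * g) = L h * Re (g t).
  move=> h14 him.
  have Lh1 : 4^-1 <= L h.
    have := @positive_le (4^-1%:C *: (1 : Cb R K)) h; rewrite positiveZ L1 mulr1; apply => s.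
    by rewrite Cb_constE; have /andP[] := h14 s.
  have Lh2 : L h <= 3 / 4.
    have := @positive_le h ((3 / 4)%:C *: (1 : Cb R K)); rewrite positiveZ L1 mulr1; apply => s.
    by rewrite Cb_constE; have /andP[] := h14 s.
  have Lh0 : 0 < L h by lra.
  have L1h : L (1 - h) = 1 - L h by rewrite positiveB L1.
  have [||||eh _] := ext (density h) (density (1 - h)) (L h).
  - apply: density_state => // s; split; last exact: him.
    by have /andP[] := h14 s; lra.
  - apply: density_state => [s|]; last by rewrite L1h; lra.
    split; first by rewrite Cb_addE Cb_oppE ReCB/=; have /andP[] := h14 s; lra.
    by rewrite Cb_addE Cb_oppE ImCB/= him subr0.
  - by apply/andP; split; lra.
  - apply/funext => f; apply: complex_ext; rewrite /evaluation/density/= L1h.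
      rewrite !mul0r !subr0 !mulrA ![_ * L (_ * _)]mulrC -!mulrA !mulfV; [|lra|lra].
      by rewrite !mulr1 -LD -mulrDl subrKC mul1r LB// subn_valP.
    rewrite !mul0r !addr0 !mulrA ![_ * - _]mulrC -!mulrA !mulfV; [|lra|lra].
    rewrite !mulr1 -opprD -LD -mulrDl subrKC mul1r LB ?rpredZ ?subn_valP//.
    by rewrite Cb_scaleE ReCM/=; ring.
  move/(congr1 (fun phi => Re (phi (MkSub gB)))) : eh.
  rewrite /density/evaluation /= => <-; rewrite mulrCA mulfV ?mulr1 ?gt_eqF//.
(* An affine change brings [k] into [1/4, 3/4]. Both sides of the identity are linear in [k], and it
   holds at the constant 1, so the change can be undone. *)
pose M := rnorm k + 1.
have M0 : 0 < M by rewrite ltr_wpDl ?rnorm_ge0.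
pose q := (2^-1)%:C *: (1 : Cb R K) + ((4 * M)^-1)%:C *: k.
have Lq : L q = 2^-1 + (4 * M)^-1 * L k by rewrite LD !positiveZ L1 mulr1.
have Lqg : L (q * g) = 2^-1 * Re (g t) + (4 * M)^-1 * L (k * g).
  by rewrite mulrDl LD !Cb_scalerAl !positiveZ mul1r LB.
have := small q; rewrite Lqg Lq => hg.
have hk : (4 * M)^-1 * L (k * g) = (4 * M)^-1 * (L k * Re (g t)).
  rewrite mulrA; apply: (addrI (2^-1 * Re (g t))); rewrite -mulrDl; apply: hg => s.
    rewrite Cb_addE ReCD Cb_constE Cb_scaleE ReCM /= mul0r subr0.
    have : `|(4 * M)^-1 * Re (k s)| <= 4^-1.
      rewrite normrM ger0_norm ?invr_ge0 ?mulr_ge0 ?(ltW M0)//.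
      rewrite invfM -mulrA ler_piMr ?invr_ge0// ler_pdivrMl// mulr1.
      apply: le_trans (normr_Re _) _; apply: le_trans (rnorm_app _ _) _.
      by rewrite lerDl.
    by rewrite ler_norml => /andP[h1 h2]; apply/andP; split; lra.
  by rewrite Cb_addE ImCD Cb_constE Cb_scaleE ImCM /= kim mulr0 mul0r !addr0.
by apply: (mulfI _ hk); rewrite invr_eq0 mulf_neq0 ?gt_eqF.
Qed.

End PositiveFunctional.
End ExtremeEvaluations.

(** * The upper envelope and separation at Choquet boundary points *)

Section ChoquetBump.
Variables (R : realType) (K : topologicalType) (B : submodClosed (Cb R K)).
Hypothesis B1 : 1 \in B.
Local Open Scope complex_scope.
Local Notation Re := complex.Re.
Local Notation Im := complex.Im.

Definition majorant_values (t : K) (f : Cb R K) : set R :=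
  [set Re (g t) | g in [set g : Cb R K | g \in B /\ forall s, Re (f s) <= Re (g s)]].

(** The upper envelope of Choquet theory. A real-linear functional below it is positive and agrees
    on [B] with the real part of the evaluation at [t]. *)
Definition upper_envelope (t : K) (f : realification (Cb R K)) : R :=
  inf (majorant_values t f).

Lemma upper_envelope_le t (f g : Cb R K) : g \in B ->
  (forall s, Re (f s) <= Re (g s)) -> upper_envelope t f <= Re (g t).
Proof.
move=> gB fg; apply: ge_inf; last by exists g.
by exists (Re (f t)) => _ [h [hB fh] <-].
Qed.

Lemma majorant_values_nonempty t f : majorant_values t f !=set0.
Proof.
exists (Re (((rnorm f)%:C *: (1 : Cb R K)) t)), ((rnorm f)%:C *: (1 : Cb R K)) => //.
split; first exact: rpredZ.
by move=> s; rewrite Cb_constE /=; apply: le_trans (Re_le _) (rnorm_app _ _).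
Qed.

Lemma upper_envelope_ge t (f : Cb R K) m :
  (forall g : Cb R K, g \in B -> (forall s, Re (f s) <= Re (g s)) -> m <= Re (g t)) ->
  m <= upper_envelope t f.
Proof.
move=> mle; apply: lb_le_inf; first exact: majorant_values_nonempty.
by move=> _ [g [gB fg] <-]; exact: mle.
Qed.

Lemma upper_envelope_sublinear t : sublinear (upper_envelope t).
Proof.
have Z (a : R) (f : Cb R K) : 0 < a ->
    upper_envelope t (a *: (f : realification (Cb R K))) <= a * upper_envelope t f.
  move=> a0; rewrite -ler_pdivrMl//; apply: upper_envelope_ge => g gB fg.
  rewrite ler_pdivrMl//.
  have := @upper_envelope_le t (a%:C *: f) (a%:C *: g).
  rewrite rpredZ// Re_scaleR; apply => // s.
  by rewrite !Re_scaleR ler_pM2l.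
split=> [f1 f2|a f a0]; last first.
  apply/eqP; rewrite eq_le Z//=.
  have := @Z a^-1 (a *: f); rewrite invr_gt0 => /(_ a0).
  by rewrite scalerA mulVf ?gt_eqF// scale1r ler_pdivlMl.
rewrite -lerBlDr; apply: upper_envelope_ge => g1 g1B fg1.
rewrite lerBlDr -lerBlDl; apply: upper_envelope_ge => g2 g2B fg2.
rewrite lerBlDl -ReCD; apply: (@upper_envelope_le _ _ (g1 + g2)).
  exact: rpredD.
by move=> s; rewrite !Cb_addE !ReCD lerD.
Qed.

(** Let [h] be the real part of [g] and [L] a functional supporting the envelope at [h * h].
    Multiplicativity gives [L (h * h) = L (h * g) = L h * Re (g t) = 0]. The infimum being 0, some
    element of [B] dominates the square of [Re g] and is as small as desired at [t]. *)
Lemma extreme_upper_envelope t (g : Cb R K) :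
  extreme_point (state_space B1) (@evaluation R K B t) ->
  g \in B -> Re (g t) = 0 ->
  exists2 k : Cb R K, (forall s, Re (k s) = Re (g s) ^+ 2) &
    upper_envelope t k = 0.
Proof.
move=> ext gB gt0.
have [h hE] : exists h : Cb R K, forall s, h s = (Re (g s))%:C.
  apply: (@Cb_exists _ _ _ (rnorm g)) => [|s]; last first.
    by rewrite rnorm_RC; apply: le_trans (normr_Re _) (rnorm_app _ _).
  apply/ccontinuousP => s e e0; have := Cb_near g s e0; apply: filterS => s'.
  apply: le_lt_trans; rewrite -[_ - _]rmorphB rnorm_RC -ReCB; exact: normr_Re.
exists (h * h); first by move=> s; rewrite Cb_mulE hE ReCM /= mulr0 subr0 expr2.
have [L [LD LZ Lle Lhh]] :=
  sublinear_support (h * h : realification (Cb R K)) (upper_envelope_sublinear t).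
have LN (f : Cb R K) : L (- f) = - L f.
  have L0 : L 0 = 0 by have := LD 0 0; rewrite addr0; lra.
  by have := LD f (- f); rewrite subrr L0; lra.
have Lpos (f : Cb R K) : (forall s, 0 <= Re (f s)) -> 0 <= L f.
  move=> f0; rewrite -oppr_le0 -LN; apply: le_trans (Lle _) _.
  apply: (@upper_envelope_le t (- f) 0); first exact: rpred0.
  by move=> s; rewrite Cb_oppE ReCN oppr_le0.
have LB (f : Cb R K) : f \in B -> L f = Re (f t).
  move=> fB; apply/eqP; rewrite eq_le (le_trans (Lle _) (upper_envelope_le _ fB _))//=.
  rewrite -lerN2 -LN -ReCN; apply: le_trans (Lle _) _.
  apply: (@upper_envelope_le t (- f) (- f)) => //.
  by rewrite -scaleN1r rpredZ.
have him s : Im (h s) = 0 by rewrite hE.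
have := extreme_functional_multiplicative LD LZ Lpos LB ext him gB.
rewrite gt0 mulr0 -Lhh => <-; apply: (positive_Re LD Lpos) => s.
by rewrite !Cb_mulE !ReCM him hE !mul0r.
Qed.

Hypothesis K_compact : compact [set: K].
Hypothesis B_separates : forall s t : K, s <> t -> exists2 f, f \in B & f s <> f t.

(** If the real part fails to separate, multiplication by ['i] brings the imaginary part into play.
    The value 2 leaves room for [Re g] to stay above 1 near [s]. *)
Lemma separating_Re s t : s <> t ->
  exists g : Cb R K, [/\ g \in B, Re (g t) = 0 & Re (g s) = 2].
Proof.
move=> st; have [f fB fst] := B_separates st.
pose f0 : Cb R K := f - f t *: (1 : Cb R K).
have f0E u : f0 u = f u - f t by rewrite Cb_addE Cb_oppE Cb_constE.
have f0B : f0 \in B by rewrite /f0 -scaleNr rpredD ?rpredZ.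
have [f1 [f1B f1t f1s]] : exists f1 : Cb R K, [/\ f1 \in B, Re (f1 t) = 0 & Re (f1 s) != 0].
  have [f0s|f0s] := eqVneq (Re (f0 s)) 0; last by exists f0; rewrite f0E subrr.
  exists ('i *: f0); rewrite rpredZ// !Cb_scaleE !f0E subrr mulr0; split => //.
  rewrite ReCM /= mul0r mul1r sub0r oppr_eq0; apply/negP => /eqP f0s'.
  apply: fst; apply: complex_ext; apply/eqP; rewrite -subr_eq0.
    by rewrite -ReCB -f0E f0s.
  by rewrite -ImCB f0s'.
exists ((2 / Re (f1 s))%:C *: f1); rewrite rpredZ// !Cb_scaleE !ReCM f1t /=.
by rewrite mulr0 !mul0r !subr0 divfK.
Qed.

(** The property [Q] passes to unions by adding two functions with tolerance [e / 2], so it need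
    only be checked near a point [s] different from [t]. There a majorant of the square of [Re g]
    serves, where [g] vanishes in real part at [t] and equals 2 in real part at [s]. *)
Lemma Choquet_bump t (U : set K) (eta : R) :
  Choquet_boundary B1 t -> nbhs t U -> 0 < eta ->
  exists g : Cb R K, [/\ g \in B, forall s, 0 <= Re (g s),
    forall s, ~ U s -> 1 <= Re (g s) & Re (g t) < eta].
Proof.
move=> ext tU.
pose Q (S : set K) := forall e : R, 0 < e -> exists g : Cb R K,
  [/\ g \in B, forall s, 0 <= Re (g s), forall s, S s -> 1 <= Re (g s) & Re (g t) < e].
suff QU : Q (~` (U°)).
  move=> /QU[g [gB g0 g1 gt]]; exists g; split => // s nUs; apply: g1.
  by apply: contra_not nUs; exact: interior_subset.
apply: compact_local.
- apply: (subclosed_compact _ K_compact) => //.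
  by apply: open_closedC; exact: open_interior.
- by move=> e e0; exists 0; rewrite rpred0.
- move=> S1 S2 QS S12 e /QS[g [gB g0 g1 gt]]; exists g; split => // s /S12.
  exact: g1.
- move=> S1 S2 Q1 Q2 e e0; have e20 : 0 < e / 2 by rewrite divr_gt0.
  have [g1 [g1B g10 g11 g1t]] := Q1 _ e20.
  have [g2 [g2B g20 g21 g2t]] := Q2 _ e20.
  exists (g1 + g2); split; first exact: rpredD.
  + by move=> s; rewrite Cb_addE ReCD addr_ge0.
  + move=> s [/g11|/g21]; rewrite Cb_addE ReCD.
      by have := g20 s; lra.
    by have := g10 s; lra.
  + by rewrite Cb_addE ReCD; lra.
move=> s nUs; have st : s <> t.
  by move=> st; apply: nUs; rewrite st.
have [g [gB gt gs]] := separating_Re st.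
have [k kE kt] := extreme_upper_envelope ext gB gt.
exists [set s' | rnorm (g s' - g s) < 1]; first exact: Cb_near.
move=> e e0.
have hinf : has_inf (majorant_values t k).
  split; first exact: majorant_values_nonempty.
  by exists (Re (k t)) => _ [h [_ kh] <-].
have [_ [h [hB kh] <-]] := inf_adherent e0 hinf.
rewrite -[inf _]/(upper_envelope t k) kt add0r => hte.
exists h; split => // s'; first by apply: le_trans (kh s'); rewrite kE sqr_ge0.
move=> /= gs'; apply: le_trans (kh s'); rewrite kE.
have := le_lt_trans (normr_Re _) gs'; rewrite ReCB gs ltr_norml => /andP[h1 h2].
have : 1 <= Re (g s') by lra.
by move=> h3; rewrite expr2 -[1]mulr1 ler_pM.
Qed.

End ChoquetBump.

(** * Domination of states and faces *)

Section Faces.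
Variables (R : realType) (K : topologicalType) (B : submodClosed (Cb R K)).
Hypothesis B1 : 1 \in B.
Local Open Scope complex_scope.
Local Notation Re := complex.Re.
Local Notation Im := complex.Im.
Implicit Types (phi psi : subnormed B -> C_ R) (E W : set K).

(* For a state [phi], the existence of a representing measure of [phi]
   carried by [E]. *)
Definition dominated E phi := forall (g : subnormed B) (m : R),
  (forall s, E s -> Re (val g s) <= m) -> Re (phi g) <= m.

Definition face E := forall phi psi (l : R),
  state_space B1 phi -> state_space B1 psi -> 0 < l < 1 ->
  dominated E (l%:C *: phi + (1 - l)%:C *: psi) ->
  dominated E phi /\ dominated E psi.

Lemma dominatedS E1 E2 phi : E1 `<=` E2 -> dominated E1 phi -> dominated E2 phi.
Proof. by move=> E12 d1 g m gm; apply: d1 => s /E12; exact: gm. Qed.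

(** Adding a large constant [n] flattens the effect of the imaginary part: the norm of [g + n] is at
    most the square root of [(m + n)^2 + M^2], which exceeds [m + n] by less than [d] for large
    [n]. *)
Lemma state_dominated (t : K) phi : state_space B1 phi -> dominated setT phi.
Proof.
move=> /(state_spaceP B1 t)[lphi phile phi1] g m gm; rewrite leNgt; apply/negP => mg.
pose d := Re (phi g) - m; have d0 : 0 < d by rewrite subr_gt0.
pose M := rnorm (val g); have M0 : 0 <= M by exact: rnorm_ge0.
(* The first two terms make [m + n] and [Re (g s) + n] nonnegative, the last one gives
   [M ^+ 2 <= d * (m + n)]. *)
pose n := M + `|m| + M ^+ 2 / d.
have Md0 : 0 <= M ^+ 2 / d by rewrite divr_ge0 ?sqr_ge0// ltW.
have m_le : - `|m| <= m <= `|m| by rewrite -ler_norml.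
have M2 : M ^+ 2 <= d * (m + n).
  by rewrite mulrC -ler_pdivrMr// /n; move: m_le => /andP[? ?]; lra.
have nn (r : R) : 0 <= r -> Re (phi g) + n <= r -> (m + n) ^+ 2 + M ^+ 2 < r ^+ 2.
  move=> r0 nr; have rE : m + n + d <= r by rewrite /d; lra.
  have : (m + n + d) ^+ 2 <= r ^+ 2.
    by rewrite ler_sqr ?nnegrE// /n; move: m_le => /andP[? ?]; lra.
  apply: lt_le_trans; have : 0 < d ^+ 2 by rewrite exprn_gt0.
  by have := sqr_ge0 M; nra.
pose r := Num.sqrt ((m + n) ^+ 2 + M ^+ 2).
have r2 : r ^+ 2 = (m + n) ^+ 2 + M ^+ 2 by rewrite sqr_sqrtr// addr_ge0 ?sqr_ge0.
have := nn r (sqrtr_ge0 _); rewrite r2 ltxx => rn; apply/notF/rn.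
have -> : Re (phi g) + n = Re (phi (g + n%:C *: MkSub B1)).
  by rewrite (linearD_of lphi) (linearZ_of lphi) phi1 ReCD [_ *: 1]mulr1.
apply: le_trans (Re_le _) _; apply: le_trans (phile _) _.
apply/(rnorm_CbP _ (sqrtr_ge0 _)) => s.
apply: rnorm_le; rewrite ?sqrtr_ge0// r2.
rewrite Cb_addE Cb_constE ReCD ImCD /= addr0; apply: lerD.
  have gs := gm s I.
  have := normr_Re (val g s); rewrite ler_norml => /andP[g1 _].
  have := rnorm_app (val g) s; rewrite -/M => gM.
  by rewrite ler_sqr ?nnegrE /n; move: m_le => /andP[? ?]; lra.
rewrite -real_normK ?num_real// ler_sqr ?nnegrE//.
exact: le_trans (normr_Im _) (rnorm_app _ _).
Qed.

(** Penalisation: [n * (Re f - m)] is nonpositive on [E], and for large [n] it pushes [Re g] below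
    [M + e] away from the set where [m <= Re f]; by compactness one [n] serves all of [E]. Since
    [phi] gives [f] a real part of at least [m], the penalty does not lower [Re (phi g)]. *)
Lemma dominated_argmax E (f : subnormed B) (m : R) phi : compact E ->
  linear phi -> (forall s, E s -> Re (val f s) <= m) -> dominated E phi ->
  m <= Re (phi f) -> dominated [set s | E s /\ m <= Re (val f s)] phi.
Proof.
move=> cE lphi fm dphi mf g M gM; apply/ler_addgt0Pr => e e0.
pose Q (S : set K) := exists2 n : R, 0 <= n & forall s, S s -> E s ->
  Re (val g s) + n * (Re (val f s) - m) <= M + e.
have [n n0 gn] : Q E; last first.
  have := dphi (g + n%:C *: f) (M + e + n * m); rewrite (linearD_of lphi) (linearZ_of lphi).
  have -> : Re (phi g + n%:C *: phi f) = Re (phi g) + n * Re (phi f).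
    by rewrite ReCD ReCM /= mul0r subr0.
  have : n * m <= n * Re (phi f) by rewrite ler_wpM2l.
  move=> nm H; have : Re (phi g) + n * Re (phi f) <= M + e + n * m; last by lra.
  apply: H => s Es; rewrite Cb_addE ReCD Re_scaleR.
  by have := gn s Es Es; lra.
apply: compact_local => //.
- by exists 0.
- by move=> S1 S2 [n n0 Sn] S12; exists n => // s /S12; exact: Sn.
- move=> S1 S2 [n1 n10 Sn1] [n2 n20 Sn2]; exists (n1 + n2); first exact: addr_ge0.
  move=> s S12 Es; have := fm s Es; rewrite -subr_le0 => fms.
  case: S12 => [/Sn1|/Sn2] /(_ Es).
    by have := mulr_ge0_le0 n20 fms; lra.
  by have := mulr_ge0_le0 n10 fms; lra.
move=> s Es; have [mfs|fsm] := leP m (Re (val f s)).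
  exists [set s' | rnorm (val g s' - val g s) < e]; first exact: Cb_near.
  exists 0 => // s' /= gs' _; rewrite mul0r addr0.
  have := gM s (conj Es mfs); have := le_lt_trans (Re_le _) gs'; rewrite ReCB.
  lra.
pose d := m - Re (val f s); have d0 : 0 < d by rewrite subr_gt0.
exists [set s' | rnorm (val f s' - val f s) < d / 2].
  by apply: Cb_near; rewrite divr_gt0.
(* Where [Re f <= m - d / 2], this factor makes the penalty at most [- (rnorm g + |M|)], which
   brings [Re g] below [M]. *)
exists (2 * (rnorm (val g) + `|M|) / d).
  by rewrite divr_ge0 ?(ltW d0)// mulr_ge0// addr_ge0 ?rnorm_ge0.
move=> s' /= fs' _.
have h1 : Re (val f s') - m <= - (d / 2).
  by have := le_lt_trans (Re_le _) fs'; rewrite ReCB /d; lra.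
have h2 : 0 <= 2 * (rnorm (val g) + `|M|) / d.
  by rewrite divr_ge0 ?(ltW d0)// mulr_ge0// addr_ge0 ?rnorm_ge0.
have := ler_wpM2l h2 h1.
rewrite (_ : _ * - (d / 2) = - (rnorm (val g) + `|M|)); last by field; lra.
have := le_trans (Re_le _) (rnorm_app (val g) s').
have : - `|M| <= M by rewrite lerNl -normrN ler_norm.
lra.
Qed.

(** Testing domination with [- f] shows that the combination takes a value of at least [m] at [f]
    (in real part), whereas each of the two states takes at most [m]; hence both take exactly
    [m]. *)
Lemma face_argmax E (f : subnormed B) (m : R) : compact E -> face E ->
  (forall s, E s -> Re (val f s) <= m) ->
  face [set s | E s /\ m <= Re (val f s)].
Proof.
move=> cE fE fm phi psi l sphi spsi /andP[l0 l1] dom.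
have [dphi dpsi] : dominated E phi /\ dominated E psi.
  apply: (fE phi psi l) => //; first by rewrite l0.
  by apply: dominatedS dom => s [].
have phim := dphi f m fm; have psim := dpsi f m fm.
have lin (chi : subnormed B -> C_ R) : state_space B1 chi -> linear chi by case.
have chim : m <= l * Re (phi f) + (1 - l) * Re (psi f).
  rewrite -lerN2; have := dom (- f) (- m); rewrite ReCD !ReCM /= !mul0r !subr0.
  rewrite -[- f]scaleN1r !linearZ_of; [|exact: lin|exact: lin].
  rewrite !scaleN1r !ReCN !mulrN -opprD; apply => s [_].
  by rewrite -lerN2 -ReCN; exact.
have h1 := ler_wpM2l (ltW l0) phim.
have h2 : (1 - l) * Re (psi f) <= (1 - l) * m by rewrite ler_wpM2l// subr_ge0 ltW.
split; apply: dominated_argmax => //; try exact: lin.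
  by rewrite -(ler_pM2l l0); lra.
by rewrite -(@ler_pM2l _ (1 - l)) ?subr_gt0//; lra.
Qed.

End Faces.

(** Among finitely many members of a chain the largest contains the others, so a single [W] remains
    in the finite subcover. *)
Lemma chain_compact (T : topologicalType) (C O : set T) (F : set (set T)) :
  compact C -> F !=set0 -> (forall W, F W -> open W) -> total_on F subset ->
  open O -> C `<=` O `|` \bigcup_(W in F) W -> exists2 W, F W & C `\` W `<=` O.
Proof.
move=> cC [W0 FW0] oF Ftot oO CO.
pose Q (S : set T) := exists2 W, F W & S `\` W `<=` O.
apply: (@compact_local _ C Q cC).
- by exists W0 => // s [].
- by move=> S1 S2 [W FW SW] S12; exists W => // s [/S12 S2s Ws]; exact: SW.
- move=> S1 S2 [W1 F1 S1W] [W2 F2 S2W].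
  have [W12|W21] := Ftot _ _ F1 F2.
    exists W2 => // s [[S1s|S2s] nW]; last exact: S2W.
    by apply: S1W; split => // /W12.
  exists W1 => // s [[S1s|S2s] nW]; first exact: S1W.
  by apply: S2W; split => // /W21.
move=> s /CO[Os|[W FW Ws]].
  by exists O; [exact: open_nbhs_nbhs|exists W0 => // x []].
exists W; first by apply: open_nbhs_nbhs; split => //; exact: oF.
by exists W => // x [].
Qed.

(** * Minimal faces: the Choquet boundary is norming *)

Section Norming.
Variables (R : realType) (K : topologicalType) (B : submodClosed (Cb R K)).
Hypothesis B1 : 1 \in B.
Hypothesis K_compact : compact [set: K].
Hypothesis B_separates : forall s t : K, s <> t -> exists2 f, f \in B & f s <> f t.
Local Open Scope complex_scope.
Local Notation Re := complex.Re.
Local Notation Im := complex.Im.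
Local Notation face := (face B1).

Lemma open_Re_lt (f : Cb R K) (m : R) : open [set s | Re (f s) < m].
Proof.
rewrite openE => s /= fsm; have d0 : 0 < m - Re (f s) by rewrite subr_gt0.
have := Cb_near f s d0; apply: filterS => s' fs'.
by have := le_lt_trans (Re_le _) fs'; rewrite ReCB /=; lra.
Qed.

(** A bound [m] for [Re g] on the intersection of the faces holds up to [e] on one of them, by
    compactness, so domination by every member passes to the intersection. *)
Lemma face_chain (E : set K) (F : set (set K)) : compact E -> F !=set0 ->
  (forall W, F W -> open W /\ face (E `\` W)) -> total_on F subset ->
  face (E `\` \bigcup_(W in F) W).
Proof.
move=> cE F0 FW Ftot phi psi l sphi spsi l01 dom.
have domW W : F W -> dominated (E `\` W) phi /\ dominated (E `\` W) psi.
  move=> /[dup] FW' /FW[_ fW]; apply: (fW _ _ l) => //; apply: dominatedS dom.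
  by move=> s [Es nF]; split => // Ws; apply: nF; exists W.
have lim (chi : subnormed B -> C_ R) :
    (forall W, F W -> dominated (E `\` W) chi) ->
    dominated (E `\` \bigcup_(W in F) W) chi.
  move=> dchi g m gm; apply/ler_addgt0Pr => e e0.
  have [| | |W FW' EW] :=
      @chain_compact _ E [set s | Re (val g s) < m + e] F cE F0 _ Ftot.
  - by move=> W /FW[].
  - exact: open_Re_lt.
  - move=> s Es; have [Fs|nFs] := pselect ((\bigcup_(W in F) W) s); first by right.
    by left => /=; rewrite (le_lt_trans (gm s _)) ?ltrDl.
  - by apply: (dchi W FW') => s /EW /ltW.
by split; apply: lim => W /domW[].
Qed.

Lemma exists_Re_max (E : set K) (f : Cb R K) : compact E -> E !=set0 ->
  exists2 t, E t & forall s, E s -> Re (f s) <= Re (f t).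
Proof.
move=> cE E0; have [|t + tmax] := compact_EVT_max E0 cE (f := fun s => Re (f s)).
  by apply: continuous_subspaceT; apply: Re_continuous; exact: Cb_continuous.
by rewrite inE => Et; exists t => // s Es; apply: tmax; rewrite inE.
Qed.

(** Testing domination with [g], [- g] and ['i *: g] shows that the evaluation is the only state
    dominated by the point [t]. *)
Lemma Choquet_boundary_face1 (t : K) : face [set t] -> Choquet_boundary B1 t.
Proof.
move=> ft; split; first exact: evaluation_state.
have dom1 (chi : subnormed B -> C_ R) : state_space B1 chi ->
    dominated [set t] chi -> chi = @evaluation R K B t.
  move=> [lchi _ _ _] d; have le g : Re (chi g) <= Re (val g t).
    by apply: d => s ->.
  have eqRe g : Re (chi g) = Re (val g t).
    apply/eqP; rewrite eq_le le /=.
    have : Re (chi (-1 *: g)) <= Re ((-1 *: val g) t) := le (-1 *: g).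
    by rewrite Cb_scaleE (linearZ_of lchi) scaleN1r mulN1r !ReCN lerN2.
  apply/funext => g; apply: complex_ext; first exact: eqRe.
  have : Re (chi ('i *: g)) = Re (('i *: val g) t) := eqRe ('i *: g).
  rewrite Cb_scaleE (linearZ_of lchi) !ReCM /= !mul0r !mul1r !sub0r.
  exact: oppr_inj.
move=> y z l sy sz l01 e.
have [|dy dz] := ft y z l sy sz l01; first by rewrite -e => g m; apply.
by split; exact: dom1.
Qed.

Lemma Choquet_boundary_max (f : Cb R K) (s : K) : f \in B ->
  exists2 t, Choquet_boundary B1 t & Re (f s) <= Re (f t).
Proof.
move=> fB; have [|s0 _ s0max] := @exists_Re_max [set: K] f K_compact.
  by exists s.
pose E0 := [set u : K | [set: K] u /\ Re (f s0) <= Re (f u)].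
have fT : face [set: K] by move=> phi psi l sphi spsi _ _; split; exact: state_dominated.
have fE0 : face E0.
  by apply: (@face_argmax _ _ _ _ [set: K] (MkSub fB)) => // u _; exact: s0max.
have cE0 : compact E0.
  apply: (subclosed_compact _ K_compact) => //.
  rewrite (_ : E0 = ~` [set u | Re (f u) < Re (f s0)]).
    by apply: open_closedC; exact: open_Re_lt.
  apply/seteqP; split => [u [_ fu] /=|u /= /negP fu].
    by apply/negP; rewrite -leNgt.
  by split => //; rewrite leNgt.
(* The removed open sets are ordered by inclusion, so a maximal [W] yields a minimal face. *)
pose P (W : set K) := [/\ open W, (E0 `\` W) !=set0 & face (E0 `\` W)].
have [F FP Ftot|W [[oW W0 fW] Wmax]] := @Zorn_bigcup _ P.
  have [->|/set0P F0] := eqVneq F set0.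
    rewrite bigcup_set0; split; rewrite ?setD0//; first exact: open0.
    by exists s0.
  split; first by apply: bigcup_open => W /FP[].
    apply: contrapT => nE.
    have [||W /FP[_ [u EWu] _] EW] := chain_compact cE0 F0 _ Ftot (@open0 K).
    - by move=> W /FP[].
    - move=> u E0u; right; apply: contrapT => nu; apply: nE; exists u.
      by split.
    - by have := EW u EWu.
  by apply: face_chain => // W /FP[].
have cEW : compact (E0 `\` W) by apply: compact_closedI => //; exact: open_closedC.
(* Minimality makes every [Re h] constant: otherwise the points where it is not maximal could be
   removed as well, leaving a smaller nonempty face. *)
have const (h : Cb R K) u v : h \in B -> (E0 `\` W) u -> (E0 `\` W) v ->
    Re (h u) <= Re (h v).
  move=> hB Eu Ev; have [w Ew wmax] := exists_Re_max h cEW W0.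
  apply: le_trans (wmax u Eu) _; rewrite leNgt; apply/negP => vw.
  apply: (Wmax (W `|` [set x | Re (h x) < Re (h w)])).
    split; first exact: subsetUl.
    by case: Ev => _ nWv /(_ v) sub; apply/nWv/sub; right.
  have EE : E0 `\` (W `|` [set x | Re (h x) < Re (h w)]) =
      [set x | (E0 `\` W) x /\ Re (h w) <= Re (h x)].
    apply/seteqP; split => x /=.
      by move=> [E0x nWx]; split; [split => // Wx; apply: nWx; left|
        rewrite leNgt; apply/negP => hx; apply: nWx; right].
    by move=> [[E0x nWx] hx]; split => // -[//|]; rewrite ltNge hx.
  split; first by apply: openU => //; exact: open_Re_lt.
    by rewrite EE; exists w.
  by rewrite EE; apply: (@face_argmax _ _ _ _ (E0 `\` W) (MkSub hB)) => // x /wmax.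
have [t Et] := W0.
have EWt : E0 `\` W = [set t].
  apply/seteqP; split => [u Eu /=|_ -> //]; apply: contrapT => ut.
  have [h hB hut] := B_separates ut; apply: hut; apply: complex_ext.
    by apply/le_anti; rewrite !const.
  have : Re (('i *: h) u) = Re (('i *: h) t) by apply/le_anti; rewrite !const ?rpredZ.
  by rewrite !Cb_scaleE !ReCM /= !mul0r !mul1r !sub0r => /oppr_inj.
exists t; first by apply: Choquet_boundary_face1; rewrite -EWt.
by apply: le_trans (s0max s I) _; case: Et => [[]].
Qed.

Lemma Choquet_boundary_norming (f : Cb R K) (s : K) : f \in B ->
  exists2 t, Choquet_boundary B1 t & rnorm (f s) <= rnorm (f t).
Proof.
move=> fB; have [w w1 wf] := unit_rotation (f s).
have [|t Ct] := @Choquet_boundary_max (w *: f) s; first exact: rpredZ.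
rewrite Cb_scaleE wf /= => ft; exists t => //; apply: le_trans ft _.
by apply: le_trans (Re_le _) _; rewrite rnormM w1 mul1r.
Qed.

End Norming.

(** * Resolvents and their dyadic averages *)

Section StepFunction.
Variable R : realType.
Local Open Scope complex_scope.
Local Notation Re := complex.Re.
Local Notation Im := complex.Im.
Implicit Types z u : C_ R.

Lemma rnormV u : rnorm (u^-1 : C_ R) = (rnorm u)^-1.
Proof.
have [->|u0] := eqVneq u 0; first by rewrite invr0 rnorm0 invr0.
have nu0 : rnorm u != 0 by apply: contra u0 => /eqP/rnorm0_eq0 ->.
by apply: (mulfI nu0); rewrite -rnormM !mulfV// rnorm1.
Qed.

Lemma ReCV u : Re (u^-1) = Re u / rnorm u ^+ 2.
Proof. by rewrite sqr_rnorm; case: u. Qed.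

Lemma ImCV u : Im (u^-1) = - Im u / rnorm u ^+ 2.
Proof. by rewrite sqr_rnorm; case: u => a b /=; rewrite mulNr. Qed.

Section Resolvent.
Variable u : C_ R.
Hypothesis u_ge0 : 0 <= Re u.
Let D := rnorm (1 + u) ^+ 2.

Let DE : D = (1 + Re u) ^+ 2 + Im u ^+ 2.
Proof. by rewrite /D sqr_rnorm ReCD ImCD /= add0r. Qed.

Let D_ge1 : 1 <= D.
Proof. by rewrite DE; have := sqr_ge0 (Im u); have := sqr_ge0 (Re u); have := u_ge0; nra. Qed.

Let D_gt0 : 0 < D. Proof. exact: lt_le_trans D_ge1. Qed.

Lemma resolvent_neq0 : 1 + u != 0.
Proof. by apply: contraTneq D_ge1 => e; rewrite /D e rnorm0 expr0n ler10. Qed.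

Lemma Re_resolvent : 0 <= Re ((1 + u)^-1) <= 1.
Proof.
rewrite ReCV ReCD -/D /=; apply/andP; split.
  by rewrite divr_ge0 ?(ltW D_gt0)// addr_ge0.
by rewrite ler_pdivrMr// mul1r DE; have := sqr_ge0 (Im u); have := sqr_ge0 (Re u); have := u_ge0; nra.
Qed.

(** The squared modulus of [1 + u] is at least 1 and at least that of [u]. Both estimates are kept,
    because their minimum is summable over dyadic scales in both directions. *)
Lemma Im_resolvent : `|Im ((1 + u)^-1)| <= Num.min (rnorm u) (rnorm u)^-1.
Proof.
rewrite ImCV ImCD -/D /= add0r normrM normrN normfV (gtr0_norm D_gt0) le_min.
apply/andP; split; rewrite ler_pdivrMr//.
  by apply: le_trans (normr_Im u) _; rewrite ler_peMr ?rnorm_ge0.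
have [u0|u0] := eqVneq (rnorm u) 0.
  by rewrite (rnorm0_eq0 u0) /= normr0 mulr_ge0 ?invr_ge0 ?rnorm_ge0 ?ltW.
have {}u0 : 0 < rnorm u by rewrite lt_neqAle eq_sym u0 rnorm_ge0.
rewrite ler_pdivlMl//; apply: (@le_trans _ _ (rnorm u ^+ 2)).
  by rewrite expr2 ler_wpM2l ?rnorm_ge0// normr_Im.
by rewrite sqr_rnorm DE lerD2r ler_sqr ?nnegrE ?addr_ge0// lerDr.
Qed.

Lemma resolvent_near1 : rnorm ((1 + u)^-1 - 1 : C_ R) <= rnorm u.
Proof.
have -> : (1 + u)^-1 - 1 = - u * (1 + u)^-1 :> C_ R.
  by apply: (mulIf resolvent_neq0); rewrite mulrBl mulfVK ?resolvent_neq0//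
    mulVf ?resolvent_neq0// mul1r opprD addNKr.
rewrite rnormM rnormN rnormV ler_pdivrMr; last first.
  by rewrite lt_neqAle rnorm_ge0 andbT eq_sym; apply: contraNneq resolvent_neq0 =>
    /rnorm0_eq0 ->.
rewrite ler_peMr ?rnorm_ge0//.
by rewrite -(@ler_pXn2r _ 2)// ?nnegrE ?rnorm_ge0// expr1n.
Qed.

Lemma resolvent_small (m : R) : 0 < m -> m <= Re u ->
  rnorm ((1 + u)^-1 : C_ R) <= m^-1.
Proof.
move=> m0 mu; rewrite rnormV lef_pV2 ?posrE//.
  by apply: le_trans (Re_le _); rewrite ReCD /=; lra.
by apply: lt_le_trans (Re_le _); rewrite ReCD /=; lra.
Qed.

End Resolvent.

(* The arguments [r / 2 ^ j] run through a geometric progression, so only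
   boundedly much mass lies near 1; with [x = 2 ^ n / r] the partial sums are
   bounded by [x] while [x <= 1], and by [4 - 2 / x] afterwards. *)
Lemma dyadic_min_sum (r : R) n : 0 < r ->
  \sum_(j < n) Num.min (r / 2 ^+ j) (r / 2 ^+ j)^-1 <= 4.
Proof.
move=> r0; pose x k := 2 ^+ k / r : R.
have x0 k : 0 < x k by rewrite divr_gt0// exprn_gt0.
suff H k : \sum_(j < k) Num.min (r / 2 ^+ j) (r / 2 ^+ j)^-1 <=
    if x k <= 1 then x k else 4 - 2 / x k.
  apply: le_trans (H n) _; case: ifPn => [|_]; first by lra.
  by rewrite lerBlDr lerDl divr_ge0// ltW.
elim: k => [|k IH].
  rewrite big_ord0; case: ifPn => [_|]; first exact: ltW.
  rewrite -ltNge => x1; have : (x 0%N)^-1 <= 1 by rewrite invf_le1 ?ltW.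
  lra.
rewrite big_ord_recr /=; set m := Num.min _ _.
have mx : m <= x k by rewrite /m invf_div ge_min lexx orbT.
have mxV : m <= (x k)^-1 by rewrite /x invf_div /m ge_min lexx.
have xS : x k.+1 = 2 * x k by rewrite /x exprS mulrA.
rewrite xS; have xx : x k * (x k)^-1 = 1 by rewrite mulfV ?gt_eqF.
have xk0 := x0 k; have xV0 : 0 < (x k)^-1 by rewrite invr_gt0.
have e2 : 2 / (2 * x k) = (x k)^-1 by rewrite invfM mulrA mulfV ?mul1r.
rewrite e2; apply: le_trans (lerD IH (lexx m)) _.
case: ifPn => x1; case: ifPn => x2; rewrite -?ltNge in x1 x2 *; try lra.
by nra.
Qed.

Definition step_function (N : nat) z : C_ R :=
  (N%:R^-1)%:C * \sum_(j < N) (1 + ((2 ^+ j)^-1)%:C * z)^-1.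

Lemma rnorm_sum (I : Type) (s : seq I) (F : I -> C_ R) :
  rnorm (\sum_(i <- s) F i : C_ R) <= \sum_(i <- s) rnorm (F i).
Proof.
elim/big_ind2: _ => [|x a y b xa yb|//]; first by rewrite rnorm0.
by apply: le_trans (rnormD _ _) _; exact: lerD.
Qed.

Lemma sum_le_const (N : nat) (F : 'I_N -> R) (c : R) : (0 < N)%N ->
  (forall j, F j <= c) -> N%:R^-1 * \sum_(j < N) F j <= c.
Proof.
move=> N0 Fc; rewrite ler_pdivrMl ?ltr0n//.
apply: le_trans (ler_sum _ (fun j _ => Fc j)) _.
by rewrite sumr_const card_ord mulr_natl.
Qed.

Section StepFunctionBounds.
Variables (N : nat) (z : C_ R).
Hypotheses (N0 : (0 < N)%N) (z_ge0 : 0 <= Re z).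

Let u j : C_ R := ((2 ^+ j)^-1)%:C * z.

Let u_ge0 j : 0 <= Re (u j).
Proof. by rewrite ReCM /= mul0r subr0 mulr_ge0// invr_ge0 exprn_ge0. Qed.

Let p_gt0 j : 0 < 2 ^+ j :> R. Proof. exact: exprn_gt0. Qed.

Let rnorm_u j : rnorm (u j) = rnorm z / 2 ^+ j.
Proof. by rewrite rnormM rnorm_RC ger0_norm 1?mulrC// invr_ge0 ltW. Qed.

Let Re_sum (F : 'I_N -> C_ R) : Re (\sum_(j < N) F j) = \sum_(j < N) Re (F j).
Proof. by elim/big_ind2: _ => // x a y b <- <-; exact: ReCD. Qed.

Let Im_sum (F : 'I_N -> C_ R) : Im (\sum_(j < N) F j) = \sum_(j < N) Im (F j).
Proof. by elim/big_ind2: _ => // x a y b <- <-; exact: ImCD. Qed.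

Lemma Re_step_function : 0 <= Re (step_function N z) <= 1.
Proof.
rewrite /step_function ReCM /= mul0r subr0 Re_sum; apply/andP; split.
  rewrite mulr_ge0 ?invr_ge0//; apply: sumr_ge0 => j _.
  by have /andP[] := Re_resolvent (u_ge0 j).
by apply: sum_le_const => // j; have /andP[] := Re_resolvent (u_ge0 j).
Qed.

(** The imaginary parts sum to at most 4 in modulus, however many scales are averaged. *)
Lemma Im_step_function : `|Im (step_function N z)| <= 4 / N%:R.
Proof.
rewrite /step_function ImCM /= mul0r addr0 Im_sum normrM ger0_norm ?invr_ge0//.
rewrite mulrC ler_wpM2r ?invr_ge0//; apply: le_trans (ler_norm_sum _ _ _) _.
have [z0|z0] := eqVneq (rnorm z) 0.
  rewrite big1// => j _; rewrite (rnorm0_eq0 z0) mulr0 addr0 invr1 /=.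
  exact: normr0.
apply: le_trans (@dyadic_min_sum (rnorm z) N _); last first.
  by rewrite lt_neqAle eq_sym z0 rnorm_ge0.
by apply: ler_sum => j _; rewrite -rnorm_u; exact: Im_resolvent (u_ge0 j).
Qed.

Lemma step_function_near1 : rnorm (step_function N z - 1 : C_ R) <= rnorm z.
Proof.
have -> : step_function N z - 1 =
    (N%:R^-1)%:C * \sum_(j < N) ((1 + u j)^-1 - 1) :> C_ R.
  rewrite big_split /= mulrDr sumr_const card_ord; congr (_ + _).
  rewrite mulNrn mulrN; congr (- _); apply/esym.
  by rewrite fmorphV /= rmorph_nat mulVf// pnatr_eq0 -lt0n.
rewrite rnormM rnorm_RC ger0_norm ?invr_ge0//.
apply: le_trans (ler_wpM2l (_ : 0 <= N%:R^-1) (rnorm_sum _ _)) _.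
  by rewrite invr_ge0.
apply: sum_le_const => // j; apply: le_trans (resolvent_near1 (u_ge0 j)) _.
by rewrite rnorm_u ler_pdivrMr// ler_peMr ?rnorm_ge0// exprn_ege1// ler1n.
Qed.

Lemma step_function_small (m : R) : 0 < m -> m <= Re z ->
  rnorm (step_function N z) <= 2 ^+ N / m.
Proof.
move=> m0 mz; rewrite rnormM rnorm_RC ger0_norm ?invr_ge0//.
apply: le_trans (ler_wpM2l (_ : 0 <= N%:R^-1) (rnorm_sum _ _)) _.
  by rewrite invr_ge0.
apply: sum_le_const => // j.
apply: le_trans (@resolvent_small (u j) (m / 2 ^+ j) _ _) _.
- by rewrite divr_gt0.
- by rewrite ReCM /= mul0r subr0 mulrC ler_wpM2l// invr_ge0 ltW.
by rewrite invf_div ler_wpM2r ?invr_ge0 ?(ltW m0)// ler_eXn2l// ?ltr1n// ltnW.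
Qed.

End StepFunctionBounds.
End StepFunction.

(** * Peak functions at Choquet boundary points *)

Section Bumps.
Variables (R : realType) (K : topologicalType).
Hypothesis K_compact : compact [set: K].
Local Open Scope complex_scope.
Local Notation Re := complex.Re.
Local Notation Im := complex.Im.

Lemma near_unit_segment (z w : C_ R) (d d' e : R) : d + d' <= e ->
  - d <= Re w <= 1 + d -> `|Im w| <= d -> rnorm (z - w) <= d' ->
  - e <= Re z <= 1 + e /\ `|Im z| <= e.
Proof.
move=> de /andP[w1 w2] w3 zw.
have := le_trans (normr_Re _) zw; have := le_trans (normr_Im _) zw.
move: w3; rewrite ReCB ImCB !ler_norml => /andP[a1 a2] /andP[b1 b2] /andP[c1 c2].
by split; apply/andP; split; lra.
Qed.

Section Subalgebra.
Variable B : submodClosed (Cb R K).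
Hypothesis B1 : 1 \in B.
Hypothesis BM : {in B &, forall f g, f * g \in B}.

(* With [q = 1 - v / C], [C] large, the partial sums [b] of the Neumann series
   of [1 / v] satisfy [1 - v b = q ^ n], and [|q|^2 <= 1 - 1 / C]. *)
Lemma approx_inverse (v : Cb R K) (d : R) : v \in B ->
  (forall s, 1 <= Re (v s)) -> 0 < d ->
  exists2 b, b \in B & forall s, rnorm (b s - (v s)^-1 : C_ R) <= d.
Proof.
move=> vB v1 d0; pose C := (rnorm v + 1) ^+ 2.
have M1 : 1 <= rnorm v + 1 by rewrite lerDr rnorm_ge0.
have C1 : 1 <= C by rewrite exprn_ege1.
have C0 : 0 < C by exact: lt_le_trans C1.
pose q : Cb R K := 1 - (C^-1)%:C *: v.
have qE s : q s = 1 - (C^-1)%:C * v s by [].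
have qB : q \in B by rewrite /q -scaleNr rpredD ?rpredZ.
have Neumann n : exists2 b, b \in B & forall s, 1 - v s * b s = q s ^+ n.
  elim: n => [|n [b bB bE]].
    by exists 0 => [|s]; rewrite ?rpred0// expr0 [X in _ - X]mulr0 subr0.
  exists ((C^-1)%:C *: (1 : Cb R K) + q * b).
    by rewrite rpredD ?rpredZ// BM.
  move=> s; rewrite Cb_addE Cb_constE Cb_mulE exprS -bE qE; ring.
pose rho := 1 - C^-1.
have rho0 : 0 <= rho by rewrite subr_ge0 invf_le1.
have rho1 : rho < 1 by rewrite ltrBlDr ltrDl invr_gt0.
(* The square is [1 - 2 Re v / C + |v|^2 / C^2], where [Re v >= 1] and [|v|^2 <= C]. *)
have q2 s : rnorm (q s) ^+ 2 <= rho.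
  have v2 : Re (v s) ^+ 2 + Im (v s) ^+ 2 <= C.
    rewrite -sqr_rnorm ler_sqr ?nnegrE ?rnorm_ge0 ?(le_trans ler01 M1)//.
    by apply: le_trans (rnorm_app v s) _; rewrite lerDl.
  rewrite sqr_rnorm qE ReCB ImCB ReCM ImCM /= !mul0r subr0 addr0 sub0r sqrrN.
  have Ci0 : 0 < C^-1 by rewrite invr_gt0.
  have CC : C^-1 * C = 1 by rewrite mulVf ?gt_eqF.
  have h1 : C^-1 * (Re (v s) ^+ 2 + Im (v s) ^+ 2) <= 1.
    by rewrite -CC ler_pM2l.
  have h2 := ler_wpM2l (ltW Ci0) h1.
  have h3 := ler_wpM2l (ltW Ci0) (v1 s).
  by rewrite /rho; lra.
have [n rhon] : exists n, rho ^+ n <= d ^+ 2.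
  have : rho ^+ n @[n --> \oo] --> (0 : R).
    by apply: cvg_expr; rewrite ger0_norm.
  move=> /cvgrPdist_lt/(_ (d ^+ 2)); rewrite exprn_gt0// => /(_ isT)[n _ /(_ n)].
  rewrite /= leqnn sub0r normrN => /(_ isT) h; exists n.
  exact: le_trans (ler_norm _) (ltW h).
have [b bB bE] := Neumann n; exists b => // s.
have v0 : v s != 0.
  by apply: contraTneq (v1 s) => ->; rewrite /= ler10.
have -> : b s - (v s)^-1 = - (q s ^+ n) * (v s)^-1 :> C_ R.
  by rewrite -bE opprB mulrBl mul1r mulrAC mulfV// mul1r.
rewrite rnormM rnormN rnormX rnormV.
have vn1 : (rnorm (v s))^-1 <= 1.
  by rewrite invf_le1 ?(lt_le_trans ltr01)//; exact: le_trans (v1 s) (Re_le _).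
apply: le_trans (ler_wpM2l _ vn1) _; first by rewrite exprn_ge0 ?rnorm_ge0.
rewrite mulr1 -(@ler_pXn2r _ 2)// ?nnegrE ?exprn_ge0 ?rnorm_ge0 ?(ltW d0)//.
rewrite exprAC; apply: le_trans rhon.
by apply: lerXn2r => //; rewrite nnegrE sqr_ge0.
Qed.

(** Each term of the average is the inverse of an element of [B] whose real part is at least 1. *)
Lemma approx_step_function (g : Cb R K) (N : nat) (d : R) : g \in B ->
  (forall s, 0 <= Re (g s)) -> (0 < N)%N -> 0 < d ->
  exists2 f, f \in B & forall s, rnorm (f s - step_function N (g s) : C_ R) <= d.
Proof.
move=> gB g0 N0 d0.
have inv (j : 'I_N) : exists b : Cb R K, b \in B /\
    forall s, rnorm (b s - (1 + ((2 ^+ j)^-1)%:C * g s)^-1 : C_ R) <= d.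
  have [|s|b bB bE] := @approx_inverse ((1 : Cb R K) + ((2 ^+ j)^-1)%:C *: g) d _ _ d0.
  - by rewrite rpredD// rpredZ.
  - by rewrite Cb_addE ReCD Re_scaleR lerDl mulr_ge0// invr_ge0 exprn_ge0.
  - by exists b.
have [b bP] := choice inv.
exists ((N%:R^-1)%:C *: \sum_(j < N) b j).
  by rewrite rpredZ// rpred_sum// => j _; exact: (bP j).1.
move=> s; rewrite Cb_scaleE /step_function -mulrBr.
have -> : (\sum_(j < N) b j) s = \sum_(j < N) b j s.
  by elim/big_ind2: _ => // x a y c <- <-.
rewrite -sumrB rnormM rnorm_RC ger0_norm ?invr_ge0//.
apply: le_trans (ler_wpM2l (_ : 0 <= N%:R^-1) (rnorm_sum _ _)) _.
  by rewrite invr_ge0.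
by apply: sum_le_const => // j; exact: (bP j).2.
Qed.

Hypothesis B_separates : forall s t : K, s <> t -> exists2 f, f \in B & f s <> f t.

Lemma Choquet_boundary_peak t (U : set K) (e : R) :
  Choquet_boundary B1 t -> nbhs t U -> 0 < e ->
  exists f : Cb R K, [/\ f \in B,
    forall s, - e <= Re (f s) <= 1 + e /\ `|Im (f s)| <= e,
    forall s, ~ U s -> rnorm (f s) <= e & rnorm (f t - 1 : C_ R) <= e].
Proof.
move=> Ct tU e0; have e20 : 0 < e / 2 by rewrite divr_gt0.
(* The order of choices matters: [N] makes the imaginary parts at most [e / 2]; then [M] makes the
   step function at most [e / 2] where the real part reaches [M]; last comes [g], so small at [t]
   that [M * Re (g t) < e / 2]. *)
pose N := (Num.truncn (8 / e)).+1.
have N0 : (0 < N)%N by [].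
have Ne : 4 / N%:R <= e / 2.
  rewrite ler_pdivrMr ?ltr0n//; have := truncnS_gt (8 / e); rewrite -/N => /ltW.
  by rewrite ler_pdivrMr//; lra.
pose M := 2 ^+ N * (2 / e).
have M0 : 0 < M by rewrite mulr_gt0 ?exprn_gt0// divr_gt0.
have [g [gB g0 g1 gt]] := Choquet_bump K_compact B_separates Ct tU (divr_gt0 e20 M0).
(* Subtracting an imaginary constant makes [h t] real, hence small, and leaves the real parts
   unchanged. *)
pose h : Cb R K := M%:C *: (g - ('i * (Im (g t))%:C) *: (1 : Cb R K)).
have hB : h \in B by rewrite rpredZ// -scaleNr rpredD// rpredZ.
have Reh s : Re (h s) = M * Re (g s).
  rewrite Re_scaleR Cb_addE Cb_oppE Cb_constE ReCB ReCM /=; ring.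
have Imh : Im (h t) = 0.
  rewrite Cb_scaleE ImCM Cb_addE Cb_oppE Cb_constE ImCB ImCM /=; ring.
have h0 s : 0 <= Re (h s) by rewrite Reh mulr_ge0 ?(ltW M0).
have [f fB fh] := approx_step_function hB h0 N0 e20.
exists f; split => // [s|s nUs|].
- have [F0 F1] := andP (Re_step_function N0 (h0 s)).
  apply: (near_unit_segment (d := e / 2) _ _ _ (fh s)); first by rewrite -splitr.
    by rewrite (le_trans _ F0) ?oppr_le0 ?(ltW e20)//= (le_trans F1)// lerDl ltW.
  exact: le_trans (Im_step_function N (h0 s)) Ne.
- have : rnorm (step_function N (h s)) <= e / 2.
    apply: le_trans (@step_function_small _ N (h s) N0 M M0 _) _.
      by rewrite Reh ler_peMr ?(ltW M0)// g1.
    by rewrite /M invfM mulrA mulfV ?mul1r ?invf_div// gt_eqF// exprn_gt0.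
  have := rnormD (f s - step_function N (h s)) (step_function N (h s)).
  by rewrite subrK; have := fh s; lra.
- have : rnorm (h t) <= e / 2.
    apply: le_trans (rnorm_ReIm _) _; rewrite Imh normr0 addr0 ger0_norm//.
    by rewrite Reh mulrC -ler_pdivlMr// ltW.
  have := rnormBD (f t) (step_function N (h t)) 1.
  by have := step_function_near1 N0 (h0 t); have := fh t; lra.
Qed.

End Subalgebra.

Definition has_bumps (A : submodClosed (Cb R K)) (Omega : set K) :=
  forall t (U : set K) (e : R), Omega t -> nbhs t U -> 0 < e ->
  exists f : Cb R K, [/\ f \in A,
    forall s, - e <= Re (f s) <= 1 + e /\ `|Im (f s)| <= e,
    forall s, ~ U s -> rnorm (f s) <= e & rnorm (f t - 1 : C_ R) <= e].

(** No function of [A] can peak at a common zero of [A], so such points are excluded. *)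
Definition Choquet_support (A B : submodClosed (Cb R K)) (B1 : 1 \in B) : set K :=
  [set t | Choquet_boundary B1 t /\ exists2 a, a \in A & a t != 0].

(* A peak function of [B] becomes one of the ideal [A] after multiplication by
   some [a \in A] with [a t = 1], close to 1 on the support of the peak. *)
Lemma Choquet_support_bumps (A B : submodClosed (Cb R K)) (B1 : 1 \in B) :
  {in B &, forall f g, f * g \in B} -> {in B & A, forall f g, f * g \in A} ->
  (forall s t : K, s <> t -> exists2 f, f \in B & f s <> f t) ->
  has_bumps A (Choquet_support A B1).
Proof.
move=> BM BA Bsep t U e [Ct [a' a'A a't]] tU e0.
pose a : Cb R K := (a' t)^-1 *: a'.
have aA : a \in A by rewrite rpredZ.
have at1 : a t = 1 by rewrite Cb_scaleE mulVf.
(* The bound [d <= 1] gives [|f| <= 3], so [|a - 1| < e / 6] costs at most [e / 2] where it holds;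
   elsewhere [|f| <= d], and [d * (rnorm a + 1) <= e / 2]. *)
pose d := Num.min 1 (e / (2 * (rnorm a + 2))).
have na0 : 0 <= rnorm a by exact: rnorm_ge0.
have a20 : 0 < 2 * (rnorm a + 2) by rewrite mulr_gt0// ltr_wpDl//.
have d0 : 0 < d by rewrite lt_min ltr01 divr_gt0.
have d1 : d <= 1 by rewrite ge_min lexx.
have de : 2 * (d * (rnorm a + 2)) <= e.
  have : d <= e / (2 * (rnorm a + 2)) by rewrite ge_min lexx orbT.
  by rewrite ler_pdivlMr//; lra.
have nad : 0 <= d * rnorm a by rewrite mulr_ge0// ltW.
have de2 : d <= e / 2 by move: de nad d0; clear; lra.
have dae : d * (rnorm a + 1) <= e / 2 by move: de d0; clear; lra.
have e60 : 0 < e / 6 by rewrite divr_gt0.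
have tV : nbhs t (U `&` [set s | rnorm (a s - a t) < e / 6]).
  by apply: filterI => //; exact: Cb_near.
have [f [fB fs fU ft]] := Choquet_boundary_peak BM Bsep Ct tV d0.
have faf s : rnorm ((f * a) s - f s : C_ R) <= e / 2.
  have -> : (f * a) s - f s = f s * (a s - 1) by rewrite Cb_mulE mulrBr mulr1.
  rewrite rnormM.
  have [[_ as1]|nV] := pselect ((U `&` [set s | rnorm (a s - a t) < e / 6]) s).
    have f3 : rnorm (f s) <= 3.
      apply: le_trans (rnorm_ReIm _) _; have [/andP[f1 f2] f3] := fs s.
      have : `|Re (f s)| <= 2.
        by rewrite ler_norml; move: d1 f1 f2; clear => *; apply/andP; split; lra.
      by move: d1 f3; clear; lra.
    have {}as1 : rnorm (a s - 1 : C_ R) < e / 6 by rewrite -at1.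
    apply: le_trans (ler_wpM2r (rnorm_ge0 _) f3) _.
    by move: as1; clear; lra.
  have fd := fU s nV.
  have am : rnorm (a s - 1 : C_ R) <= rnorm a + 1.
    apply: le_trans (rnormD _ _) _.
    by rewrite rnormN rnorm1 lerD2r; exact: rnorm_app.
  apply: le_trans (ler_pM (rnorm_ge0 _) (rnorm_ge0 _) fd am) dae.
exists (f * a); split; first exact: BA.
- move=> s; have [f1 f2] := fs s; apply: near_unit_segment f1 f2 (faf s).
  by rewrite [leRHS]splitr lerD2r.
- move=> s nU; have fd : rnorm (f s) <= d by apply: fU => -[].
  rewrite Cb_mulE rnormM.
  apply: le_trans (ler_pM (rnorm_ge0 _) (rnorm_ge0 _) fd (rnorm_app a s)) _.
  by move: dae d0 e0; clear; lra.
- rewrite Cb_mulE at1 mulr1; apply: le_trans ft _.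
  by move: de2 e0; clear; lra.
Qed.

(** The norming point found in the boundary of [B] is not a common zero of [A], since [f] itself is
    nonzero there. *)
Lemma Choquet_support_norming (A B : submodClosed (Cb R K)) (B1 : 1 \in B) :
  {subset A <= B} ->
  (forall s t : K, s <> t -> exists2 f, f \in B & f s <> f t) ->
  forall (f : Cb R K) s, f \in A -> f s != 0 ->
  exists2 t, Choquet_support A B1 t & rnorm (f s) <= rnorm (f t).
Proof.
move=> AB Bsep f s fA fs.
have [t Ct ft] := Choquet_boundary_norming B1 K_compact Bsep s (AB _ fA).
exists t => //; split => //; exists f => //.
apply/negP => /eqP ft0; move: ft; rewrite ft0 rnorm0 => fs0.
have : rnorm (f s) = 0 by apply/le_anti; rewrite fs0 rnorm_ge0.
by move=> /rnorm0_eq0 /eqP; apply/negP.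
Qed.

End Bumps.

(** * Closure, distance and convexity with real scalars *)

Section NormedClosure.
Variables (R : realType) (V : normedModType R[i]).
Local Open Scope complex_scope.

Lemma closure_rnormP (X : set V) (x : V) :
  closure X x <-> forall e : R, 0 < e -> exists2 y, X y & rnorm (y - x) < e.
Proof.
split=> [clX e e0|apx U /nbhs_ballP[e /= e0 eU]].
  have [y [Xy xy]] : X `&` ball x e%:C !=set0.
    by apply: clX; apply: nbhsx_ballx; rewrite (ltcR 0).
  by exists y => //; move: xy; rewrite -ball_normE /= -rnormE ltcR rnormBC.
have er : e = (complex.Re e)%:C by rewrite RRe_real// gtr0_real.
have [|y Xy xy] := apx (complex.Re e); first by move: e0; rewrite er ltcR.
exists y; split => //; apply: eU.
by rewrite -ball_normE /= er -rnormE ltcR rnormBC.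
Qed.

Lemma dist_lt (X : set V) (x y : V) (e : R) : X y -> rnorm (x - y) < e ->
  (dist x X < e%:E)%E.
Proof.
move=> Xy xy; apply: (@le_lt_trans _ _ (rnorm (x - y))%:E); last by rewrite lte_fin.
by apply: ereal_inf_lbound; exists y.
Qed.

Lemma convex_set_real (S : set V) :
  (forall x y (r : R), 0 <= r <= 1 -> S x -> S y ->
    S (r%:C *: x + (1 - r)%:C *: y)) ->
  @convex_set R[i] V S.
Proof.
move=> cS x y l; rewrite !inE => Sx Sy.
have l0 : 0 <= l%:num by [].
have l1 : l%:num <= 1 by [].
have lr : l%:num = (complex.Re l%:num)%:C by rewrite RRe_real// ger0_real.
rewrite [conv _ _ _](_ : _ =
  (complex.Re l%:num)%:C *: x + (1 - complex.Re l%:num)%:C *: y).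
  by apply: cS => //; move: l0 l1; rewrite lr ler0c (lecR _ 1) => -> ->.
by rewrite -[LHS]/(l%:num *: x + (1 - l%:num) *: y) {1 2}lr rmorphB.
Qed.

Lemma conv_hull_midpoint (F : set V) (x y : V) : F x -> F y ->
  conv_hull F (2^-1 *: (x + y)).
Proof.
move=> Fx Fy S [cS FS].
have h01 : 0 <= (2^-1 : R[i]) <= 1.
  by rewrite invr_ge0 ler0n invf_le1 ?ler1n ?ltr0n.
have /set_mem := cS x y (Itv01 (andP h01).1 (andP h01).2)
  (mem_set (FS _ Fx)) (mem_set (FS _ Fy)).
congr S; rewrite -[LHS]/(2^-1 *: x + (1 - 2^-1) *: y) scalerDr.
by congr (_ + _ *: _); field.
Qed.

End NormedClosure.

(** * Completeness of [Cb] with explicit rates *)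

Section UniformLimits.
Variables (R : realType) (T : topologicalType).
Local Open Scope complex_scope.
Local Notation Re := complex.Re.
Local Notation Im := complex.Im.

Let err (n : nat) : R := n.+1%:R^-1.

Let err_small (e : R) : 0 < e -> exists n, err n < e.
Proof.
move=> e0; exists (Num.truncn e^-1).
by rewrite invf_plt ?posrE ?ltr0n// truncnS_gt.
Qed.

(** The intervals of radius [err n] about [x n] meet pairwise, so the supremum of their left
    endpoints lies in all of them. *)
Lemma real_cauchy_limit (x : nat -> R) :
  (forall n m, `|x n - x m| <= err n + err m) ->
  exists l, forall n, `|x n - l| <= err n.
Proof.
move=> xc; pose S := [set x n - err n | n in setT].
have xlb n m : x n - err n <= x m + err m.
  by have := xc n m; rewrite ler_norml => /andP[_]; lra.
have ubS m : ubound S (x m + err m) by move=> _ [n _ <-].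
exists (sup S) => n; rewrite ler_norml; apply/andP; split.
  have : sup S <= x n + err n by apply: ge_sup => //; exists (x 0%N - err 0%N), 0%N.
  lra.
have : x n - err n <= sup S.
  by apply: ub_le_sup; [exists (x 0%N + err 0%N)|exists n].
lra.
Qed.

Lemma Cb_cauchy_limit (F : nat -> Cb R T) :
  (forall n m, rnorm (F n - F m) <= err n + err m) ->
  exists f, forall n, rnorm (F n - f) <= 2 * err n.
Proof.
move=> Fc.
have ptw t n m : rnorm (F n t - F m t) <= err n + err m.
  exact: le_trans (rnorm_app (F n - F m) t) (Fc n m).
have limRe t : exists l, forall n, `|Re (F n t) - l| <= err n.
  apply: real_cauchy_limit => n m; rewrite -ReCB.
  exact: le_trans (normr_Re _) (ptw t n m).
have limIm t : exists l, forall n, `|Im (F n t) - l| <= err n.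
  apply: real_cauchy_limit => n m; rewrite -ImCB.
  exact: le_trans (normr_Im _) (ptw t n m).
have [a aP] := choice limRe; have [b bP] := choice limIm.
pose f t : C_ R := a t +i* b t.
have fP n t : rnorm (F n t - f t) <= 2 * err n.
  apply: le_trans (rnorm_ReIm _) _; rewrite ReCB ImCB /=.
  by have := aP t n; have := bP t n; lra.
have cf : continuous f.
  apply/ccontinuousP => t e e0; have e80 : 0 < e / 8 by rewrite divr_gt0.
  have [n ne] := err_small e80.
  have := Cb_near (F n) t e80; apply: filterS => s Fs.
  have := rnormBD (f s) (F n s) (f t); have := rnormBD (F n s) (F n t) (f t).
  by rewrite (rnormBC (f s) (F n s)); have := fP n s; have := fP n t; lra.
have [|g gE] := Cb_exists (M := rnorm (F 0%N) + 2 * err 0%N) cf.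
  move=> t; rewrite -[f t](subKr (F 0%N t)).
  apply: le_trans (rnormD _ _) _; rewrite rnormN lerD//; exact: rnorm_app.
exists g => n; apply/rnorm_CbP; first by rewrite mulr_ge0// invr_ge0.
by move=> t; rewrite Cb_addE Cb_oppE gE.
Qed.

End UniformLimits.

(** * Isometric restriction and C-richness *)

Section Restrictions.
Variables (R : realType) (K : topologicalType) (A : submodClosed (Cb R K)).
Variable Omega : set K.
Hypothesis Omega_norming : forall (f : Cb R K) s, f \in A -> f s != 0 ->
  exists2 t, Omega t & rnorm (f s) <= rnorm (f t).
Hypothesis Omega_bumps : has_bumps A Omega.
Local Open Scope complex_scope.
Local Notation Re := complex.Re.
Local Notation Im := complex.Im.
Local Notation J := (restrJ Omega A).

Definition omega_point t (Ot : Omega t) : Omega := exist _ t (mem_set Ot).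

Lemma restrJE (f : subnormed A) t : J f t = val f (set_val t).
Proof. by []. Qed.

Lemma restrJ_isometry (f : subnormed A) : rnorm (J f) = rnorm f.
Proof.
apply/eqP; rewrite eq_le; apply/andP; split.
  by apply/rnorm_CbP; [exact: rnorm_ge0|move=> t; exact: (rnorm_app (val f))].
rewrite -[rnorm f]/(rnorm (val f)); apply/rnorm_CbP; first exact: rnorm_ge0.
move=> s; have [->|fs] := eqVneq (val f s) 0; first by rewrite rnorm0 rnorm_ge0.
have [t Ot st] := Omega_norming (subn_valP f) fs.
exact: le_trans st (rnorm_app (J f) (omega_point Ot)).
Qed.

Lemma restrJ_linear : linear J.
Proof.
move=> a f g; apply: Cb_ext => t; rewrite Cb_addE Cb_scaleE !restrJE.
have -> : val (a *: f + g) = a *: val f + val g by [].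
by rewrite Cb_addE Cb_scaleE. Qed.

Lemma range_restrJ_submod : submod_closed (mem (range J)).
Proof.
split; first by apply/mem_set; exists 0 => //; exact: linear0_of restrJ_linear.
move=> a _ _ /set_mem[f _ <-] /set_mem[g _ <-]; apply/mem_set.
by exists (a *: f + g) => //; exact: restrJ_linear.
Qed.

(** Since restriction is isometric, approximants of [g] in the range lift to a Cauchy sequence in
    [A]; its limit lies in [A] and restricts to [g]. *)
Lemma range_restrJ_closed : closed [set f | f \in A] -> closed (range J).
Proof.
move=> Acl g /closure_rnormP gcl.
have app n : exists f : subnormed A, rnorm (J f - g) < n.+1%:R^-1.
  have [|_ [f _ <-] fg] := gcl n.+1%:R^-1; first by rewrite invr_gt0 ltr0n.
  by exists f.
have [F FP] := choice app.
have [f fP] : exists f, forall n, rnorm (val (F n) - f) <= 2 * n.+1%:R^-1.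
  apply: Cb_cauchy_limit => n m.
  rewrite -[X in X <= _]/(rnorm (F n - F m)) -restrJ_isometry.
  rewrite (linearB_of restrJ_linear); apply: le_trans (rnormBD _ g _) _.
  by rewrite (rnormBC g); apply: lerD; exact: ltW.
have small (e : R) : 0 < e -> exists n, 3 * n.+1%:R^-1 < e.
  move=> e0; exists (Num.truncn (e / 3)^-1).
  by rewrite mulrC -ltr_pdivlMr// invf_plt ?posrE ?ltr0n ?divr_gt0// truncnS_gt.
have fA : f \in A.
  apply: Acl; apply/closure_rnormP => e /small[n ne].
  exists (val (F n)); first exact: subn_valP.
  apply: le_lt_trans (fP n) (le_lt_trans _ ne).
  by rewrite ler_wpM2r ?invr_ge0// ler_nat.
exists (MkSub fA) => //; apply: Cb_ext => t; rewrite -[LHS]/(f (set_val t)).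
apply/eqP; rewrite -subr_eq0; apply/eqP/rnorm0_eq0/le_anti.
rewrite rnorm_ge0 andbT; apply/ler_addgt0Pr => e /small[n ne]; rewrite add0r.
have h1 : rnorm (val (F n) (set_val t) - f (set_val t)) <= 2 * n.+1%:R^-1.
  exact: le_trans (rnorm_app (val (F n) - f) _) (fP n).
have h2 : rnorm (val (F n) (set_val t) - g t) <= n.+1%:R^-1.
  exact: le_trans (rnorm_app (J (F n) - g) t) (ltW (FP n)).
apply: le_trans (rnormBD _ (val (F n) (set_val t)) _) _.
rewrite (rnormBC (f _)); apply: le_trans (lerD h1 h2) _.
by rewrite (_ : _ + _ = 3 * n.+1%:R^-1 :> R) ?(ltW ne)//; ring.
Qed.

Lemma bump_C_rich (e : R) (U : set Omega) : 0 < e -> open U -> U !=set0 ->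
  exists h : Cb R Omega, [/\ rnorm h = 1, forall t, 0 <= h t <= 1, supp h `<=` U
    & (dist h (range J) < e%:E)%E].
Proof.
move=> e0 [V oV VU] [t Ut].
have Vt : V (set_val t) by move: Ut; rewrite -VU.
pose d := Num.min 12^-1 (e / 6).
have d0 : 0 < d by rewrite lt_min divr_gt0// invr_gt0 ltr0n.
have d12 : 12 * d <= 1.
  by rewrite mulrC -ler_pdivlMr ?ltr0n// mul1r ge_min lexx.
have de : 6 * d <= e by rewrite mulrC -ler_pdivlMr ?ltr0n// ge_min lexx orbT.
have Ot : Omega (set_val t) by exact: set_valP.
have [f [fA fs fV ft]] := Omega_bumps Ot (open_nbhs_nbhs (conj oV Vt)) d0.
have [fJ fJE rfJ] : exists2 fJ : Cb R Omega,
    (forall x, fJ x = f (set_val x)) & range J fJ.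
  by exists (J (MkSub fA)) => [x|]; [rewrite restrJE|exists (MkSub fA)].
(* As [12 * d <= 1], the affine map is nonpositive up to [3 / 2 * d] and at least 1 from [1 - d] on;
   it moves values between [- d] and [1 + d] by at most [3 * d]. *)
pose r x : R := clip ((1 + 4 * d) * Re (fJ x) - 2 * d).
have r0 x : 0 <= r x by exact: clip_ge0.
have r1 x : r x <= 1 by exact: clip_le1.
have rf x : `|r x - Re (fJ x)| <= 4 * d.
  have [fd _] := fs (set_val x); rewrite -fJE in fd.
  rewrite -(subrKA (clip (Re (fJ x)))); apply: le_trans (ler_normD _ _) _.
  rewrite [X in _ + X]distrC (_ : 4 * d = 3 * d + d); last by ring.
  apply: lerD (clip_near (ltW d0) fd); apply: le_trans (clip_lipschitz _ _) _.
  by move/andP: fd => [f1 f2]; rewrite ler_norml; apply/andP; split; nra.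
have [h hE] : exists h : Cb R Omega, forall x, h x = (r x)%:C.
  apply: (@Cb_exists _ _ _ 1) => [|x]; last by rewrite rnorm_RC ger0_norm.
  apply/ccontinuousP => x a a0; have a20 : 0 < a / 2 by rewrite divr_gt0.
  have := Cb_near fJ x a20; apply: filterS => x' fx.
  rewrite -[_ - _]rmorphB rnorm_RC.
  apply: le_lt_trans (clip_lipschitz _ _) _.
  have := le_lt_trans (normr_Re _) fx; rewrite ReCB => fxx.
  have -> : (1 + 4 * d) * Re (fJ x') - 2 * d - ((1 + 4 * d) * Re (fJ x) - 2 * d) =
      (1 + 4 * d) * (Re (fJ x') - Re (fJ x)) by ring.
  have c2 : 1 + 4 * d <= 2 by lra.
  rewrite normrM ger0_norm; last by lra.
  by apply: le_lt_trans (ler_wpM2r (normr_ge0 _) c2) _; lra.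
exists h; split.
- apply/eqP; rewrite eq_le; apply/andP; split.
    by apply/rnorm_CbP => // x; rewrite hE rnorm_RC ger0_norm.
  apply: le_trans (rnorm_app h t); rewrite hE rnorm_RC ger0_norm//.
  have := le_trans (normr_Re _) ft; rewrite -fJE ReCB ler_norml => /andP[f1 _].
  rewrite [X in _ - X]/= in f1.
  by rewrite /r clip_eq1//; nra.
- by move=> x; rewrite hE ler0c (lecR _ 1) r0 r1.
- move=> x; apply: contraPP => nUx hx.
  (* The support is a closure, so [h] has to vanish near [x]: the threshold [3 / 2 * d] lies
     strictly above the bound [d] valid outside [V]. *)
  have fx : Re (fJ x) < 3 / 2 * d.
    have : rnorm (fJ x) <= d by rewrite fJE; apply: fV => Vx; apply: nUx; rewrite -VU.
    by move/(le_trans (Re_le _)); lra.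
  have [|y [/eqP hy fy]] := hx [set y | Re (fJ y) < 3 / 2 * d].
    by apply: open_nbhs_nbhs; split => //; exact: open_Re_lt.
  apply: hy; rewrite hE /r; congr (_ %:C); move: fy => /= fy.
  by apply: clip_eq0; nra.
- apply: (dist_lt rfJ).
  apply: (@le_lt_trans _ _ (5 * d)); last by lra.
  apply/rnorm_CbP; first by rewrite mulr_ge0// ltW.
  move=> x; rewrite Cb_addE Cb_oppE hE; apply: le_trans (rnorm_ReIm _) _.
  rewrite ReCB ImCB /= sub0r normrN; have := rf x.
  have [_] := fs (set_val x); rewrite -fJE; lra.
Qed.

Lemma restrJ_C_rich : closed [set f | f \in A] -> C_rich (range J).
Proof.
move=> Acl; split; first exact: range_restrJ_submod.
  exact: range_restrJ_closed.
exact: bump_C_rich.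
Qed.

End Restrictions.

(** * Lushness of the restriction map *)

Section Lush.
Variables (R : realType) (K : topologicalType) (A : submodClosed (Cb R K)).
Variable Omega : set K.
Hypothesis Omega_norming : forall (f : Cb R K) s, f \in A -> f s != 0 ->
  exists2 t, Omega t & rnorm (f s) <= rnorm (f t).
Hypothesis Omega_bumps : has_bumps A Omega.
Local Open Scope complex_scope.
Local Notation Re := complex.Re.
Local Notation Im := complex.Im.
Local Notation J := (restrJ Omega A).

Lemma sphere_almost_attained (y : Cb R Omega) (d : R) : rnorm y = 1 -> 0 < d ->
  exists s, 1 - d < rnorm (y s).
Proof.
move=> y1 d0; apply: contrapT => ns.
have le s : rnorm (y s) <= 1 - d by rewrite leNgt; apply/negP => h; apply: ns; exists s.
(* When [1 - d] is negative, [Omega] would be empty, where the supremum norm is 0. *)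
have [M0|M0] := leP 0 (1 - d).
  have : rnorm y <= 1 - d by apply/rnorm_CbP.
  by rewrite y1; lra.
have : rnorm y <= 0.
  by apply/rnorm_CbP => // s; apply: le_trans (le s) (ltW M0).
by rewrite y1; lra.
Qed.

(** The number [w^-1] points in the direction of [y], so their moduli add up exactly; passing from
    [w^-1] to [x] costs at most [c]. *)
Lemma aligned_sum (w x y : C_ R) (c : R) : rnorm w = 1 ->
  w * y = (rnorm y)%:C -> rnorm (x - w^-1 : C_ R) <= c ->
  1 + rnorm y - c <= rnorm (x + y).
Proof.
move=> w1 wy xc.
have wN0 : w != 0 by apply: contra_eq_neq w1 => ->; rewrite rnorm0 eq_sym oner_eq0.
have wyE : rnorm (w^-1 + y : C_ R) = 1 + rnorm y.
  have -> : w^-1 + y = w^-1 * (1 + rnorm y)%:C :> C_ R.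
    by rewrite RCD -wy mulrDr [_ * 1]mulr1 mulKf.
  rewrite (rnormM w^-1) rnormV w1 invr1 mul1r rnorm_RC ger0_norm//.
  by rewrite addr_ge0 ?rnorm_ge0.
have := rnormD (x + y) (w^-1 - x).
have -> : x + y + (w^-1 - x) = w^-1 + y :> C_ R by rewrite addrC addrA subrK.
by rewrite wyE (rnormBC _ x); lra.
Qed.

(** A condition at the single point [s] survives convex combinations, and so controls the whole
    convex hull in the definition of lushness. *)
Lemma slice_convex (s : K) (z : C_ R) (c : R) :
  @convex_set R[i] (subnormed A)
    [set x : subnormed A | rnorm x <= 1 /\ rnorm (val x s - z) <= c].
Proof.
apply: convex_set_real => a b r /andP[r0 r1] [a1 ac] [b1 bc].
have r1' : 0 <= 1 - r by rewrite subr_ge0.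
split.
  apply: le_trans (rnormD _ _) _; rewrite !rnormZR//.
  by have := ler_wpM2l r0 a1; have := ler_wpM2l r1' b1; lra.
have -> : val (r%:C *: a + (1 - r)%:C *: b) =
    r%:C *: val a + (1 - r)%:C *: val b by [].
rewrite Cb_addE !Cb_scaleE.
have -> : r%:C * val a s + (1 - r)%:C * val b s - z =
    r%:C * (val a s - z) + (1 - r)%:C * (val b s - z) :> C_ R.
  by rewrite rmorphB rmorph1; ring.
apply: le_trans (rnormD _ _) _; rewrite !rnormM !rnorm_RC !ger0_norm//.
by have := ler_wpM2l r0 ac; have := ler_wpM2l r1' bc; lra.
Qed.

Section BumpReplacement.
Variables (x0 f : Cb R K) (s : K) (d : R).
Hypotheses (d0 : 0 < d) (x01 : rnorm x0 <= 1).

(* Near [s], [x0 + f (w - x0 s)] runs through values close to the segment from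
   [x0 s] to [w], which it reaches at [s]; the scaling brings the function back
   into the unit ball. *)
Definition bump_replace (w : C_ R) : Cb R K :=
  ((1 + 5 * d)^-1)%:C *: (x0 + (w *: f - x0 s *: f)).

Let k0 : 0 < 1 + 5 * d. Proof. by rewrite addr_gt0// mulr_gt0. Qed.

Let x0_le1 u : rnorm (x0 u) <= 1.
Proof. exact: le_trans (rnorm_app _ _) x01. Qed.

Let wx_le2 (w : C_ R) : rnorm w = 1 -> rnorm (w - x0 s) <= 2.
Proof.
move=> w1; apply: le_trans (rnormD _ _) _; rewrite rnormN w1.
by rewrite -[2]/(1 + 1) lerD2l.
Qed.

(** Before scaling, the values on [V] differ from a convex combination of [x0 s] and [w] by at most
    [d + 2 * (2 * d)], whence the factor [1 + 5 * d]; off [V] the change is at most [2 * d]. *)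
Lemma bump_replace_norm (w : C_ R) (V : set K) : rnorm w = 1 ->
  (forall u, V u -> rnorm (x0 u - x0 s) < d) ->
  (forall u, - d <= Re (f u) <= 1 + d /\ `|Im (f u)| <= d) ->
  (forall u, ~ V u -> rnorm (f u) <= d) ->
  rnorm (bump_replace w) <= 1.
Proof.
move=> w1 xV fR fV; rewrite rnormZR ?invr_ge0 ?(ltW k0)// ler_pdivrMl// mulr1.
apply/(rnorm_CbP _ (ltW k0)) => u; rewrite !Cb_addE Cb_oppE !Cb_scaleE -mulrBl.
have wx := wx_le2 w1; have x0u := x0_le1; have d_gt0 := d0.
have [Vu|nVu] := pselect (V u); last first.
  apply: le_trans (rnormD _ _) _; rewrite rnormM.
  have := ler_pM (rnorm_ge0 _) (rnorm_ge0 _) wx (fV u nVu).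
  by have := x0u u; lra.
pose r : R := clip (Re (f u)).
have r0 : 0 <= r by exact: clip_ge0.
have r1 : r <= 1 by exact: clip_le1.
have [/(clip_near (ltW d0)) rf f3] := fR u; rewrite -/r in rf.
have fr : rnorm (f u - r%:C) <= 2 * d.
  by apply: le_trans (rnorm_ReIm _) _; rewrite ReCB ImCB /= subr0; lra.
have -> : x0 u + (w - x0 s) * f u =
    ((1 - r)%:C * x0 s + r%:C * w) + ((x0 u - x0 s) + (w - x0 s) * (f u - r%:C)).
  by rewrite rmorphB rmorph1; ring.
have h1 : rnorm ((1 - r)%:C * x0 s + r%:C * w : C_ R) <= 1.
  apply: le_trans (rnormD _ _) _.
  rewrite !rnormM !rnorm_RC w1 !ger0_norm// ?subr_ge0//.
  by have := x0u s; have := rnorm_ge0 (x0 s); nra.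
apply: le_trans (rnormD _ _) _.
have := rnormD (x0 u - x0 s) ((w - x0 s) * (f u - r%:C)).
rewrite rnormM; have := ler_pM (rnorm_ge0 _) (rnorm_ge0 _) wx fr.
by have := xV u Vu; lra.
Qed.

(** The error is [2 * d], because [f s] is only close to 1, plus [5 * d] from the scaling. *)
Lemma bump_replace_near (w : C_ R) : rnorm w = 1 -> rnorm (f s - 1 : C_ R) <= d ->
  rnorm (bump_replace w) <= 1 -> rnorm (bump_replace w s - w) <= 7 * d.
Proof.
move=> w1 fs xw1; set x := bump_replace w s.
have xs1 : rnorm x <= 1 by apply: le_trans (rnorm_app _ _) xw1.
have -> : x - w = (w - x0 s) * (f s - 1) - (5 * d)%:C * x :> C_ R.
  have E : (1 + 5 * d)%:C * x = w + (w - x0 s) * (f s - 1) :> C_ R.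
    rewrite /x /bump_replace Cb_scaleE !Cb_addE Cb_oppE !Cb_scaleE.
    by rewrite mulrA -rmorphM mulfV ?gt_eqF// rmorph1; ring.
  have -> : (w - x0 s) * (f s - 1) = (1 + 5 * d)%:C * x - w :> C_ R.
    by rewrite E addrAC subrr add0r.
  by rewrite rmorphD rmorph1; move: (x) => z; ring.
have d50 : 0 <= 5 * d by rewrite mulr_ge0// ltW.
apply: le_trans (rnormD _ _) _; rewrite rnormN rnormM [X in _ + X]rnormM rnorm_RC.
rewrite ger0_norm//.
have := ler_pM (rnorm_ge0 _) (rnorm_ge0 _) (wx_le2 w1) fs.
have := ler_wpM2l d50 xs1; have := d0; lra.
Qed.

(** The two corrections cancel, which leaves only the effect of the scaling on [x0]. *)
Lemma bump_replace_mean (w1 w2 : C_ R) : w1 + w2 = 2%:R * x0 s ->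
  rnorm (x0 - 2^-1 *: (bump_replace w1 + bump_replace w2)) <= 5 * d.
Proof.
move=> w12; set k := 1 + 5 * d.
have -> : 2^-1 *: (bump_replace w1 + bump_replace w2) = (k^-1)%:C *: x0.
  rewrite /bump_replace -/k -scalerDr scalerA mulrC -scalerA; congr (_ *: _).
  have E : (w1 *: f - x0 s *: f) + (w2 *: f - x0 s *: f) = 0.
    rewrite -!scalerBl -scalerDl addrACA w12 -opprD -[X in _ - X]mulr2n.
    by rewrite -[X in _ - X]mulr_natl subrr scale0r.
  rewrite addrACA E addr0; have -> : x0 + x0 = 2%:R *: x0 by rewrite scaler_nat mulr2n.
  by rewrite scalerA mulVf ?scale1r// pnatr_eq0.
have -> : x0 - (k^-1)%:C *: x0 = (1 - k^-1)%:C *: x0.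
  by rewrite rmorphB rmorph1 scalerBl scale1r.
have kV : 0 <= 1 - k^-1 by rewrite subr_ge0 invf_le1// lerDl mulr_ge0// ltW.
rewrite rnormZR//; apply: le_trans (ler_wpM2l kV x01) _; rewrite mulr1.
have kk : k * k^-1 = 1 by rewrite mulfV// gt_eqF.
have : 0 < k^-1 by rewrite invr_gt0.
by move: kk; rewrite {1}/k; have := d0; nra.
Qed.

End BumpReplacement.

Lemma restrJ_lush : (exists f : subnormed A, f != 0) -> lush J.
Proof.
move=> [f0 f0N0]; have lJ := @restrJ_linear R K A Omega.
have iso := restrJ_isometry Omega_norming.
have Jle f : rnorm (J f) <= rnorm f by rewrite iso.
split => //; first exact: contraction_continuous.
  have nf0 : rnorm f0 != 0 by apply: contra f0N0 => /eqP/rnorm0_eq0 ->.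
  have nf1 : rnorm ((rnorm f0)^-1%:C *: f0) = 1.
    by rewrite rnormZR ?invr_ge0 ?rnorm_ge0// mulVf.
  by apply: (@op_norm1 _ _ _ _ ((rnorm f0)^-1%:C *: f0)) => //; rewrite ?iso nf1.
move=> x0 eps y x01 eps0 y1.
(* The final estimate loses [d] from [y s] and [7 * d] from [bump_replace_near]. *)
pose d := eps / 8; have d0 : 0 < d by rewrite divr_gt0.
have [s ys] := sphere_almost_attained y1 d0.
have Os : Omega (set_val s) by exact: set_valP.
have [f [fA fR fV fs]] :=
  Omega_bumps Os (Cb_near (val x0) (set_val s) d0) d0.
have [w w1 wy] := unit_rotation (y s).
have [v1 [v2 [nv1 nv2 v12]]] : exists v1 v2 : C_ R,
    [/\ rnorm v1 = 1, rnorm v2 = 1 & v1 + v2 = 2%:R * val x0 (set_val s)].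
  by apply: mean_unimodular; apply: le_trans (rnorm_app _ _) x01.
have xA v : bump_replace (val x0) f (set_val s) d v \in A.
  by rewrite rpredZ// rpredD ?subn_valP// -scaleNr rpredD ?rpredZ.
pose xj v : subnormed A := MkSub (xA v).
have xj_ball v : rnorm v = 1 -> rnorm (xj v) <= 1.
  by move=> nv; exact: (bump_replace_norm d0 x01 nv _ fR fV).
have xj_s v : rnorm v = 1 -> rnorm (val (xj v) (set_val s) - v) <= 7 * d.
  by move=> nv; apply: bump_replace_near => //; exact: xj_ball.
have inv1 (v : C_ R) : rnorm v = 1 -> rnorm (v^-1 : C_ R) = 1.
  by move=> nv; rewrite rnormV nv invr1.
have vN0 (v : C_ R) : rnorm v = 1 -> v != 0.
  by move=> nv; apply: contra_eq_neq nv => ->; rewrite rnorm0 eq_sym oner_eq0.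
(* This rotation turns the value at [s], close to [v], into one close to [w^-1], the direction of
   [y s]; [aconv] allows it to be undone when approximating [x0]. *)
pose zj (v : C_ R) : subnormed A := (w^-1 * v^-1) *: xj v.
have zj_ball v : rnorm v = 1 -> rnorm (zj v) <= 1.
  by move=> nv; rewrite rnormZ rnormM !inv1// !mul1r xj_ball.
have zj_s v : rnorm v = 1 -> rnorm (val (zj v) (set_val s) - w^-1 : C_ R) <= 7 * d.
  move=> nv; have zjE : val (zj v) = (w^-1 * v^-1) *: val (xj v) by [].
  rewrite zjE Cb_scaleE.
  have -> : w^-1 * v^-1 * val (xj v) (set_val s) - w^-1 =
      w^-1 * v^-1 * (val (xj v) (set_val s) - v) :> C_ R.
    by rewrite mulrBr -[w^-1 * v^-1 * v]mulrA mulVf ?vN0// mulr1.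
  by rewrite !rnormM !inv1// !mul1r xj_s.
exists [set zj v1; zj v2]; split.
- by move=> _ [->|->]; exact: zj_ball.
- pose S : set (subnormed A) := [set x : subnormed A |
    rnorm x <= 1 /\ rnorm (val x (set_val s) - w^-1 : C_ R) <= 7 * d].
  have FS : [set zj v1; zj v2] `<=` S.
    by move=> _ [->|->]; split; [exact: zj_ball|exact: zj_s|
                                 exact: zj_ball|exact: zj_s].
  have cS : @convex_set R[i] (subnormed A) S by exact: slice_convex.
  move=> x /(_ S (conj cS FS))[x1 xs]; split => //.
  apply: lt_le_trans (rnorm_app (J x + y) s).
  rewrite Cb_addE restrJE; have := aligned_sum w1 wy xs.
  apply: lt_le_trans.
  have <- : 8 * d = eps by rewrite /d mulrC divfK.
  by move: ys; clear; lra.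
- apply: (@dist_lt _ _ _ _ (2^-1 *: (xj v1 + xj v2))).
    have mem v : rnorm v = 1 -> [set zj v1; zj v2] (zj v) ->
        [set a *: x | a in [set a : R[i] | `|a| = 1] & x in [set zj v1; zj v2]] (xj v).
      move=> nv Fv; exists (w * v).
        by rewrite /= -(rnormE (w * v : C_ R)) rnormM w1 nv mul1r.
      exists (zj v) => //; rewrite scalerA mulrACA mulfV ?vN0// mul1r mulfV ?vN0//.
      exact: scale1r.
    by apply: conv_hull_midpoint; apply: mem => //; [left|right].
  apply: (@le_lt_trans _ _ (5 * d)).
    exact: (bump_replace_mean (x0 := val x0) f d0 x01 v12).
  by rewrite /d mulrA ltr_pdivrMr// mulrC ltr_pM2l// ltr_nat.
Qed.

End Lush.

(** * Adjoining the constants *)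

Section Unitization.
Variables (R : realType) (K : topologicalType) (A : submodClosed (Cb R K)).

Definition unitization : {pred Cb R K} :=
  fun f => `[< exists2 a, a \in A & exists c : C_ R, f = a + c *: (1 : Cb R K) >].

Lemma unitizationP (f : Cb R K) :
  reflect (exists2 a, a \in A & exists c : C_ R, f = a + c *: (1 : Cb R K))
    (f \in unitization).
Proof. exact: asboolP. Qed.

Lemma unitization_submod : submod_closed unitization.
Proof.
split.
  by apply/unitizationP; exists 0; [exact: rpred0|exists 0; rewrite scale0r addr0].
move=> k _ _ /unitizationP[a aA [c ->]] /unitizationP[b bA [d ->]].
apply/unitizationP; exists (k *: a + b); first by rewrite rpredD// rpredZ.
by exists (k * c + d); rewrite scalerDr scalerDl scalerA addrACA.
Qed.

HB.instance Definition _ := GRing.isSubmodClosed.Build _ _ unitization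
  (GRing.submod_closed_semi unitization_submod).

Lemma sub_unitization : {subset A <= unitization}.
Proof.
by move=> a aA; apply/unitizationP; exists a => //; exists 0; rewrite scale0r addr0.
Qed.

Lemma unitization1 : 1 \in unitization.
Proof.
by apply/unitizationP; exists 0; [exact: rpred0|exists 1; rewrite add0r scale1r].
Qed.

Hypothesis AM : {in A &, forall f g, f * g \in A}.

(** Being an ideal, [A] receives the products of peak functions of the unitization with its own
    elements. *)
Lemma unitization_mulA : {in unitization & A, forall f g, f * g \in A}.
Proof.
move=> _ g /unitizationP[a aA [c ->]] gA.
by rewrite mulrDl Cb_scalerAl mul1r rpredD ?AM// rpredZ.
Qed.

Lemma unitizationM : {in unitization &, forall f g, f * g \in unitization}.
Proof.
move=> f _ fB /unitizationP[a aA [c ->]].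
rewrite mulrDr Cb_scalerAr mulr1 rpredD// ?rpredZ//.
by apply: sub_unitization; exact: unitization_mulA.
Qed.

End Unitization.

Theorem theorem4p10 (R : realType) (K : topologicalType)
    (K_compact : compact [set: K]) (K_hausdorff : hausdorff_space K)
    (A : submodClosed (Cb R K)) (A_uniform : uniform_algebra A) :
  (exists Omega : set K,
     [/\ forall f : subnormed A, rnorm (restrJ Omega A f) = rnorm f,
         C_rich (range (restrJ Omega A))
       & (exists f : subnormed A, f != 0) -> lush (restrJ Omega A)]) /\
  (forall A1 : 1 \in A,
     let Omega := Choquet_boundary A1 in
     [/\ forall f : subnormed A, rnorm (restrJ Omega A f) = rnorm f,
         C_rich (range (restrJ Omega A))
       & (exists f : subnormed A, f != 0) -> lush (restrJ Omega A)]).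
Proof.
have [Acl AM Asep] := A_uniform.
(* Both claims are instances: [B] is the unitization of [A] in the first and [A] itself in the
   second. *)
have main (B : submodClosed (Cb R K)) (B1 : 1 \in B) : {subset A <= B} ->
    {in B &, forall f g, f * g \in B} -> {in B & A, forall f g, f * g \in A} ->
    let Omega := Choquet_support A B1 in
    [/\ forall f : subnormed A, rnorm (restrJ Omega A f) = rnorm f,
        C_rich (range (restrJ Omega A))
      & (exists f : subnormed A, f != 0) -> lush (restrJ Omega A)].
  move=> AB BM BA Omega.
  have Bsep s t : s <> t -> exists2 f, f \in B & f s <> f t.
    by move=> /Asep[f fA fst]; exists f => //; exact: AB.
  have norming := Choquet_support_norming K_compact B1 AB Bsep.
  have bumps := Choquet_support_bumps K_compact (B1 := B1) BM BA Bsep.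
  split; first exact: restrJ_isometry.
  - exact: restrJ_C_rich.
  - exact: restrJ_lush.
split.
  exists (Choquet_support A (unitization1 A)).
  apply: (main (unitization A)).
  - exact: sub_unitization.
  - exact: unitizationM.
  - exact: unitization_mulA.
move=> A1 Omega.
(* The constant 1 belongs to [A], so [A] has no common zero. *)
have -> : Omega = Choquet_support A A1.
  apply/seteqP; split => [t Ot|t []//]; split => //.
  by exists 1 => //; exact: oner_neq0.
exact: main.
Qed.
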